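(* Every class $\mathcal C$ of matroids has a unique fundamental type $\mathcal C_{\mathrm{fund}}$, and $\mathcal C_{\mathrm{fund}}$ consists of all isomorphism classes of matroids $M$ in $\mathcal C$ for which the canonical morphism $\Omega^<_{M,\mathcal C}:\operatorname{colim}F(\mathcal E^<_{M,\mathcal C})\to F_M$ is not an isomorphism.
   Context: Pastures are commutative monoids $P$ with absorbing $0$, $P^\times=P\setminus\{0\}$ a group, an involution $a\mapsto-a$ and a null set $N_P$ of unordered triples closed under scaling with $a+b+0\in N_P$ iff $b=-a$; morphisms preserve $0,1$, products and null sets. For a finite matroid $M$ of rank $r$ on $E$, a $P$-representation is an alternating $\Delta:E^r\to P$ nonzero exactly on ordered bases and satisfying the 3-term Plücker relations; the foundation $F_M$ is the pasture representing $P\mapsto\{P\text{-representations}\}/\text{rescaling}$. An embedded minor of $M$ is $M\setminus J/I$ with $I,J$ disjoint, $I$ independent, $J$ coindependent; it is proper if $(I,J)\neq(\emptyset,\emptyset)$. If $I'\subseteq I$, $J'\subseteq J$ there is a minor embedding $M\setminus J/I\hookrightarrow M\setminus J'/I'$ inducing (by restricting representations) a morphism of foundations. For a family $\mathcal C_0$ of isomorphism classes, $\mathcal E_{M,\mathcal C_0}$ is the diagram of all embedded minors of $M$ with isomorphism class in $\mathcal C_0$ together with all minor embeddings, $F(\cdot)$ the corresponding diagram of foundations, and $\Omega_{M,\mathcal C_0}:\operatorname{colim}F(\mathcal E_{M,\mathcal C_0})\to F_M$ the canonical morphism. A fundamental type of $\mathcal C$ is a minimal family $\mathcal C_0$ of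 isomorphism classes of matroids such that $\Omega_{M,\mathcal C_0}$ is an isomorphism for all $M\in\mathcal C$. $\mathcal E^<_{M,\mathcal C}$ is the diagram of all proper embedded minors of $M$ that are in $\mathcal C$, together with all minor embeddings, and $\Omega^<_{M,\mathcal C}$ the canonical morphism from the colimit of its foundations to $F_M$.
   Formalization: Uniqueness is stated for fundamental types consisting of matroids in C, or for arbitrary families if C is minor-closed; otherwise it fails: for C={U_{2,4}+coloop}, both C and {U_{2,4}} are minimal. Existence and the description hold for every C. *)

(* Defs.v *)
From HB Require Import structures.
From mathcomp Require Import all_boot.
From mathcomp Require Import boolp.

Set Implicit Arguments.
Unset Strict Implicit.
Unset Printing Implicit Defensive.

Declare Scope pasture_scope.
Delimit Scope pasture_scope with P.

(** * Pastures *)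

(** [pnull] is the null set: symmetry makes it a set of unordered triples. *)
Record pasture := Pasture {
  pcarrier :> Type;
  pzero : pcarrier;
  pone : pcarrier;
  pmul : pcarrier -> pcarrier -> pcarrier;
  popp : pcarrier -> pcarrier;
  pnull : pcarrier -> pcarrier -> pcarrier -> Prop;
  pmulA : associative pmul;
  pmulC : commutative pmul;
  pmul1 : left_id pone pmul;
  pmul0 : left_zero pzero pmul;
  pone_neq0 : pone <> pzero;
  pmulV : forall x, x <> pzero -> exists y, pmul x y = pone;
  poppK : involutive popp;
  pnull12 : forall a b c, pnull a b c -> pnull b a c;
  pnull23 : forall a b c, pnull a b c -> pnull a c b;
  pnullM : forall u a b c, pnull a b c -> pnull (pmul u a) (pmul u b) (pmul u c);
  pnull0 : forall a b, pnull a b pzero <-> b = popp a }.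

Arguments pzero {p}.
Arguments pone {p}.
Bind Scope pasture_scope with pcarrier.
Notation "0" := pzero : pasture_scope.
Notation "1" := pone : pasture_scope.
Notation "x * y" := (pmul x y) : pasture_scope.
Notation "- x" := (popp x) : pasture_scope.
Local Open Scope pasture_scope.

HB.instance Definition _ (P : pasture) :=
  Monoid.isComLaw.Build P 1 (@pmul P) (@pmulA P) (@pmulC P) (@pmul1 P).

Record pmorph (P Q : pasture) := PMorph {
  pfun :> P -> Q;
  pfun0 : pfun 0 = 0;
  pfun1 : pfun 1 = 1;
  pfunM : forall x y, pfun (x * y) = pfun x * pfun y;
  pfun_null : forall a b c, pnull a b c -> pnull (pfun a) (pfun b) (pfun c) }.

Definition pis_iso (P Q : pasture) (f : pmorph P Q) : Prop :=
  exists g : pmorph Q P, cancel f g /\ cancel g f.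

Section PastureTheory.
Variable P : pasture.
Implicit Types x y z : P.

Lemma pmul1r x : x * 1 = x. Proof. by rewrite pmulC pmul1. Qed.

Lemma pmul0r x : x * 0 = 0. Proof. by rewrite pmulC pmul0. Qed.

Lemma pmulCA : left_commutative (@pmul P). Proof. exact: Monoid.mulmCA. Qed.

Lemma pmulACA : interchange (@pmul P) (@pmul P). Proof. exact: Monoid.mulmACA. Qed.

Lemma pmul_neq0 x y : x <> 0 -> y <> 0 -> x * y <> 0.
Proof.
move=> nx ny xy0; have [x' x'E] := pmulV nx; apply: ny.
by rewrite -[y]pmul1 -x'E (pmulC x) -pmulA xy0 pmul0r.
Qed.

Lemma pmulI x y z : x <> 0 -> x * y = x * z -> y = z.
Proof.
move=> nx xyz; have [x' x'E] := pmulV nx.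
by rewrite -[y]pmul1 -[z]pmul1 -x'E (pmulC x) -!pmulA xyz.
Qed.

Definition pinv x : P :=
  if pselect (x <> 0) is left nx then sval (cid (pmulV nx)) else 0.

Lemma pmulxV x : x <> 0 -> x * pinv x = 1.
Proof.
by rewrite /pinv => nx; case: pselect => // ?; case: cid.
Qed.

Lemma pinv0 : pinv 0 = 0.
Proof. by rewrite /pinv; case: pselect. Qed.

Lemma pinv_neq0 x : x <> 0 -> pinv x <> 0.
Proof.
by move=> nx E; apply: (@pone_neq0 P); rewrite -(pmulxV nx) E pmul0r.
Qed.

Lemma pnull_opp x : pnull x (- x) 0. Proof. exact/pnull0. Qed.

Lemma pnull000 : @pnull P 0 0 0.
Proof. by have := pnullM 0 (pnull_opp 0); rewrite !pmul0. Qed.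

Lemma popp0 : - (0 : P) = 0.
Proof. by have /pnull0 := pnull000. Qed.

Lemma pmulrN x y : x * - y = - (x * y).
Proof. by apply/pnull0; have := pnullM x (pnull_opp y); rewrite pmul0r. Qed.

Lemma pmulNr x y : - x * y = - (x * y).
Proof. by rewrite pmulC pmulrN pmulC. Qed.

Lemma popp_eq0 x : - x = 0 <-> x = 0.
Proof.
by split=> [E|->]; [rewrite -[x]poppK E|]; rewrite popp0.
Qed.

Lemma pprod_neq0 (I : Type) (r : seq I) (F : I -> P) :
  (forall i, F i <> 0) -> \big[@pmul P/1]_(i <- r) F i <> 0.
Proof.
move=> nF; elim: r => [|i r IHr]; first by rewrite big_nil; apply: pone_neq0.
by rewrite big_cons; apply: pmul_neq0.
Qed.

Lemma pnull0_opp x y z : pnull x y z -> z = 0 -> y = - x.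
Proof. by move=> + z0; rewrite z0 => /pnull0. Qed.

End PastureTheory.

Section MorphismTheory.
Variables (P Q : pasture) (f : pmorph P Q).

Lemma pfun_neq0 x : x <> 0 -> f x <> 0.
Proof.
move=> nx fx0; apply: (@pone_neq0 Q).
by rewrite -(pfun1 f) -(pmulxV nx) pfunM fx0 pmul0.
Qed.

Lemma pfun_eq0 x : f x = 0 <-> x = 0.
Proof.
split=> [fx0|->]; last exact: pfun0.
by case: (pselect (x = 0)) => // /pfun_neq0.
Qed.

Lemma pfunN x : f (- x) = - f x.
Proof. by apply/pnull0; rewrite -(pfun0 f); apply/pfun_null/pnull_opp. Qed.

Lemma pfun_prod (I : Type) (r : seq I) (F : I -> P) :
  f (\big[@pmul P/1]_(i <- r) F i) = \big[@pmul Q/1]_(i <- r) f (F i).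
Proof. by apply: big_morph; [apply: pfunM|apply: pfun1]. Qed.

End MorphismTheory.

Lemma pmorph_eq (P Q : pasture) (f g : pmorph P Q) : f =1 g -> f = g.
Proof.
case: f g => f f0 f1 fM fN [g g0 g1 gM gN] /= /funext fg; subst g.
by congr PMorph; apply: Prop_irrelevance.
Qed.

Definition pmorph_comp (P Q S : pasture) (g : pmorph Q S) (f : pmorph P Q) :
  pmorph P S.
Proof.
exists (g \o f) => /=; first by rewrite !pfun0.
- by rewrite !pfun1.
- by move=> x y; rewrite !pfunM.
- by move=> a b c /(pfun_null f) /(pfun_null g).
Defined.

(** * Pastures given by generators and relations

Only used to show that colimits of pastures and foundations of matroids
exist. *)

Inductive pterm (X : Type) :=
  | T0 | T1 | Tg of X | Tm of pterm X & pterm X | Ti of pterm X | To of pterm X.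
Arguments T0 {X}.
Arguments T1 {X}.

Inductive pjudg (X : Type) :=
  | JE of pterm X & pterm X
  | JN of pterm X & pterm X & pterm X.

Section Presentation.
Variables (X : Type) (zg : X -> bool) (R : pjudg X -> Prop).
Local Notation term := (pterm X).

Fixpoint tz (t : term) : bool :=
  match t with
  | T0 => true
  | T1 => false
  | Tg x => zg x
  | Tm a b => tz a || tz b
  | Ti a => tz a
  | To a => tz a
  end.

Definition jvalid (j : pjudg X) : bool :=
  match j with
  | JE a b => tz a == tz b
  | JN a b c => [&& tz a ==> (tz b == tz c), tz b ==> (tz a == tz c)
                  & tz c ==> (tz a == tz b)]
  end.

Hypothesis R_valid : forall j, R j -> jvalid j.
Hypothesis R_zero : forall x, zg x -> R (JE (Tg x) T0).

Inductive pder : pjudg X -> Prop :=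
  | der_ax j : R j -> pder j
  | der_refl a : pder (JE a a)
  | der_sym a b : pder (JE a b) -> pder (JE b a)
  | der_trans a b c : pder (JE a b) -> pder (JE b c) -> pder (JE a c)
  | der_cong a b c : pder (JE a b) -> pder (JE (Tm a c) (Tm b c))
  | der_mulA a b c : pder (JE (Tm a (Tm b c)) (Tm (Tm a b) c))
  | der_mulC a b : pder (JE (Tm a b) (Tm b a))
  | der_mul1 a : pder (JE (Tm T1 a) a)
  | der_mul0 a : pder (JE (Tm T0 a) T0)
  | der_mulV a : ~~ tz a -> pder (JE (Tm a (Ti a)) T1)
  | der_inv0 a : tz a -> pder (JE (Ti a) T0)
  | der_ncong a a' b c : pder (JE a a') -> pder (JN a b c) -> pder (JN a' b c)
  | der_null12 a b c : pder (JN a b c) -> pder (JN b a c)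
  | der_null23 a b c : pder (JN a b c) -> pder (JN a c b)
  | der_nullM u a b c : pder (JN a b c) -> pder (JN (Tm u a) (Tm u b) (Tm u c))
  | der_opp a : pder (JN a (To a) T0)
  | der_opp_uniq a b : pder (JN a b T0) -> pder (JE b (To a)).

Lemma der_valid j : pder j -> jvalid j.
Proof.
elim=> //= {j}.
- by move=> a b _ /eqP->.
- by move=> a b c _ /eqP-> _ /eqP->.
- by move=> a b c _ /eqP->.
- by move=> a b c; rewrite orbA.
- by move=> a b; rewrite orbC.
- by move=> a /negbTE->.
- by move=> a ->.
- by move=> a a' b c _ /eqP->.
- by move=> a b c _; case: (tz a) (tz b) (tz c) => [] [] [].
- by move=> a b c _; case: (tz a) (tz b) (tz c) => [] [] [].
- by move=> u a b c _; case: (tz u) (tz a) (tz b) (tz c) => [] [] [] [].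
- by move=> a; case: (tz a).
- by move=> a b _; case: (tz a) (tz b) => [] [].
Qed.

Definition tcls (t : term) : term -> Prop := fun u => pder (JE t u).
Definition pquot := {S : term -> Prop | exists t, S = tcls t}.
Definition qcls t : pquot := exist _ (tcls t) (ex_intro _ t erefl).
Definition qrep (q : pquot) : term := sval (cid (svalP q)).

Lemma qrepK q : qcls (qrep q) = q.
Proof.
by rewrite /qcls /qrep; case: q => S HS; case: cid => t /= E; apply: eq_exist.
Qed.

Lemma qcls_eq t u : qcls t = qcls u <-> pder (JE t u).
Proof.
split=> [/(congr1 sval)/= E|tu].
  by have : tcls u u by [apply: der_refl]; rewrite -E.
apply: eq_exist; apply/predeqP => w; split=> tw.
  exact: der_trans (der_sym tu) tw.
exact: der_trans tu tw.
Qed.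

Lemma qrep_der t : pder (JE (qrep (qcls t)) t).
Proof. by apply/qcls_eq; rewrite qrepK. Qed.

Lemma der_congr a b c : pder (JE a b) -> pder (JE (Tm c a) (Tm c b)).
Proof.
move=> ab; apply: der_trans (der_mulC _ _) _.
exact: der_trans (der_cong _ ab) (der_mulC _ _).
Qed.

Lemma der_ncong3 a b c a' b' c' : pder (JE a a') -> pder (JE b b') ->
  pder (JE c c') -> pder (JN a b c) -> pder (JN a' b' c').
Proof.
move=> aa bb cc n; apply: (der_ncong aa); apply/der_null12.
apply: (der_ncong bb); apply/der_null12/der_null23/der_null12.
by apply: (der_ncong cc); apply/der_null12/der_null23.
Qed.

Lemma der_ocong a a' : pder (JE a a') -> pder (JE (To a) (To a')).
Proof. by move=> aa; apply/der_opp_uniq/(der_ncong aa)/der_opp. Qed.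

Lemma der_null000 : pder (JN T0 T0 T0).
Proof.
exact: (der_ncong3 (der_mul0 _) (der_mul0 _) (der_mul0 _)
         (der_nullM T0 (der_opp T0))).
Qed.

Lemma tz_der t : tz t -> pder (JE t T0).
Proof.
elim: t => //= [_|x zx|a IHa b IHb|a _|a IHa].
- exact: der_refl.
- by apply: der_ax; apply: R_zero.
- case/orP=> [/IHa ha|/IHb hb].
    exact: der_trans (der_cong _ ha) (der_mul0 _).
  apply: der_trans (der_mulC _ _) _.
  exact: der_trans (der_cong _ hb) (der_mul0 _).
- exact: der_inv0.
- move=> /IHa ha; apply: der_trans (der_ocong ha) _.
  exact/der_sym/der_opp_uniq/der_null000.
Qed.

Definition qmul p q := qcls (Tm (qrep p) (qrep q)).
Definition qopp p := qcls (To (qrep p)).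
Definition qnull p q r := pder (JN (qrep p) (qrep q) (qrep r)).

Lemma qmulE a b : qmul (qcls a) (qcls b) = qcls (Tm a b).
Proof.
apply/qcls_eq; apply: der_trans (der_cong _ (qrep_der a)) _.
exact/der_congr/qrep_der.
Qed.

Lemma qoppE a : qopp (qcls a) = qcls (To a).
Proof. exact/qcls_eq/der_ocong/qrep_der. Qed.

Lemma qnullE a b c : qnull (qcls a) (qcls b) (qcls c) <-> pder (JN a b c).
Proof.
split; apply: der_ncong3; do ?[exact: qrep_der | exact/der_sym/qrep_der].
Qed.

Lemma q_ind (Q : pquot -> Prop) : (forall t, Q (qcls t)) -> forall q, Q q.
Proof. by move=> HQ q; rewrite -[q]qrepK. Qed.

Definition presented : pasture.
Proof.
apply: (@Pasture pquot (qcls T0) (qcls T1) qmul qopp qnull).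
- elim/q_ind=> a; elim/q_ind=> b; elim/q_ind=> c.
  by rewrite !qmulE; apply/qcls_eq/der_mulA.
- elim/q_ind=> a; elim/q_ind=> b; rewrite !qmulE; exact/qcls_eq/der_mulC.
- elim/q_ind=> a; rewrite qmulE; exact/qcls_eq/der_mul1.
- elim/q_ind=> a; rewrite qmulE; exact/qcls_eq/der_mul0.
- by move/qcls_eq/der_valid.
- elim/q_ind=> a na; exists (qcls (Ti a)); rewrite qmulE.
  by apply/qcls_eq/der_mulV/negP => /tz_der/qcls_eq.
- elim/q_ind=> a; rewrite !qoppE.
  by apply/qcls_eq/der_sym/der_opp_uniq/der_null12/der_opp.
- elim/q_ind=> a; elim/q_ind=> b; elim/q_ind=> c.
  by rewrite !qnullE; apply: der_null12.
- elim/q_ind=> a; elim/q_ind=> b; elim/q_ind=> c.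
  by rewrite !qnullE; apply: der_null23.
- elim/q_ind=> u; elim/q_ind=> a; elim/q_ind=> b; elim/q_ind=> c.
  by rewrite !qmulE !qnullE; apply: der_nullM.
- elim/q_ind=> a; elim/q_ind=> b; rewrite qnullE qoppE.
  split=> [/der_opp_uniq/qcls_eq //|/qcls_eq /der_sym ab].
  by apply: der_ncong3 (der_opp a); [apply: der_refl| |apply: der_refl].
Defined.

Definition pgen (x : X) : presented := qcls (Tg x).

Section Universal.
Variables (P : pasture) (g : X -> P).

Fixpoint tev (t : term) : P :=
  match t with
  | T0 => 0
  | T1 => 1
  | Tg x => g x
  | Tm a b => tev a * tev b
  | Ti a => pinv (tev a)
  | To a => - tev a
  end.

Definition jholds (j : pjudg X) : Prop :=
  match j with
  | JE a b => tev a = tev b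
  | JN a b c => pnull (tev a) (tev b) (tev c)
  end.

Hypothesis g_unit : forall x, ~~ zg x -> g x <> 0.
Hypothesis g_R : forall j, R j -> jholds j.

Lemma tev_z t : tz t -> tev t = 0.
Proof.
elim: t => //= [x zx|a IHa b IHb|a IHa|a IHa].
- exact: (g_R (R_zero zx)).
- by case/orP=> [/IHa->|/IHb->]; [apply: pmul0|apply: pmul0r].
- by move/IHa->; apply: pinv0.
- by move/IHa->; apply: popp0.
Qed.

Lemma tev_nz t : ~~ tz t -> tev t <> 0.
Proof.
elim: t => //= [_|a IHa b IHb|a IHa|a IHa].
- exact: pone_neq0.
- by rewrite negb_or => /andP[/IHa ? /IHb ?]; apply: pmul_neq0.
- by move/IHa/pinv_neq0.
- by move/IHa => na /popp_eq0.
Qed.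

Lemma der_holds j : pder j -> jholds j.
Proof.
elim=> //= {j}.
- by move=> a b c _ -> _ ->.
- by move=> a b c _ ->.
- by move=> a b c; apply: pmulA.
- by move=> a b; apply: pmulC.
- by move=> a; apply: pmul1.
- by move=> a; apply: pmul0.
- by move=> a /tev_nz; apply: pmulxV.
- by move=> a /tev_z->; apply: pinv0.
- by move=> a a' b c _ ->.
- by move=> a b c _; apply: pnull12.
- by move=> a b c _; apply: pnull23.
- by move=> u a b c _; apply: pnullM.
- by move=> a; apply: pnull_opp.
- by move=> a b _ /pnull0.
Qed.

Lemma presented_rec :
  exists f : pmorph presented P, forall x, f (pgen x) = g x.
Proof.
pose f q := tev (qrep q).
have fE t : f (qcls t) = tev t by apply: (der_holds (qrep_der t)).
suff [h hE] : exists h : pmorph presented P, h =1 f.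
  by exists h => x; rewrite hE fE.
have f0 : f (qcls T0) = 0 by rewrite fE.
have f1 : f (qcls T1) = 1 by rewrite fE.
unshelve eexists (@PMorph presented P f f0 f1 _ _) => //.
- by elim/q_ind=> a; elim/q_ind=> b; rewrite /= qmulE !fE.
- elim/q_ind=> a; elim/q_ind=> b; elim/q_ind=> c /=.
  by rewrite !fE => /qnullE /der_holds.
Qed.

End Universal.

Lemma presented_ext (P : pasture) (f f' : pmorph presented P) :
  (forall x, f (pgen x) = f' (pgen x)) -> f =1 f'.
Proof.
move=> ff'; elim/q_ind; elim=> [||x|a IHa b IHb|a IHa|a IHa].
- by rewrite (pfun0 f) (pfun0 f').
- by rewrite (pfun1 f) (pfun1 f').
- exact: ff'.
- by rewrite -qmulE (pfunM f) (pfunM f') IHa IHb.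
- have [za|nza] := boolP (tz a).
    have -> : qcls (Ti a) = (0 : presented) by apply/qcls_eq/der_inv0.
    by rewrite (pfun0 f) (pfun0 f').
  have E : (qcls a : presented) * qcls (Ti a) = 1.
    by rewrite /= qmulE; apply/qcls_eq/der_mulV.
  have na : (qcls a : presented) <> 0.
    by move/qcls_eq/der_valid => /=; rewrite (negbTE nza).
  apply: (pmulI (pfun_neq0 (f := f) na)).
  by rewrite -pfunM E pfun1 IHa -pfunM E pfun1.
- by rewrite -qoppE (pfunN f) (pfunN f') IHa.
Qed.

Lemma pgen_eq a b : R (JE a b) -> qcls a = qcls b.
Proof. by move=> r; apply/qcls_eq/der_ax. Qed.

Lemma pgen_null a b c : R (JN a b c) ->
  @pnull presented (qcls a) (qcls b) (qcls c).
Proof. by move=> r; apply/qnullE/der_ax. Qed.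

End Presentation.

(** * Colimits of diagrams of pastures

A diagram is given by its objects and arrows; composition is irrelevant for
cocones. *)

Record diagram := Diagram {
  dindex : Type;
  dhom : dindex -> dindex -> Prop;
  dobj :> dindex -> pasture;
  dmap : forall i j, dhom i j -> pmorph (dobj i) (dobj j) }.

Record cocone (D : diagram) (P : pasture) := Cocone {
  cinj :> forall i, pmorph (D i) P;
  cinjP : forall i j (h : dhom i j) x, cinj j (dmap h x) = cinj i x }.

Definition is_colimit (D : diagram) (L : pasture) (c : cocone D L) : Prop :=
  forall (P : pasture) (k : cocone D P),
    exists f : pmorph L P, (forall i x, f (c i x) = k i x) /\
    forall g : pmorph L P, (forall i x, g (c i x) = k i x) -> g = f.

Section ColimitExists.
Variable D : diagram.
Local Notation X := {i : dindex D & D i}.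
Local Notation Tg' i x := (Tg (existT (fun i => pcarrier (D i)) i x)).

Inductive crel : pjudg X -> Prop :=
  | crel0 i : crel (JE (Tg' i 0) T0)
  | crel1 i : crel (JE (Tg' i 1) T1)
  | crelM i x y : crel (JE (Tg' i (x * y)) (Tm (Tg' i x) (Tg' i y)))
  | crelN i x y z : pnull x y z -> crel (JN (Tg' i x) (Tg' i y) (Tg' i z))
  | crelh i j (h : dhom i j) x : crel (JE (Tg' j (dmap h x)) (Tg' i x)).

Definition czero (x : X) : bool := `[< tagged x = 0 >].

Lemma crel_valid j : crel j -> jvalid czero j.
Proof.
case=> {j} /= [i|i|i x y|i x y z n|i k h x]; rewrite /czero /=.
- by apply/eqP/asboolP.
- by apply/eqP/asboolP/pone_neq0.
- apply/eqP; apply/asboolP/orP => [xy0|].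
    have [/asboolP|nx] := pselect (x = 0); first by left.
    have [/asboolP|ny] := pselect (y = 0); first by right.
    by case: (pmul_neq0 nx ny).
  by case=> /asboolP->; rewrite ?pmul0 ?pmul0r.
- have key (a b c : D i) : pnull a b c ->
      `[< c = 0 >] ==> (`[< a = 0 >] == `[< b = 0 >]).
    move=> nabc; apply/implyP => /asboolP c0.
    rewrite (pnull0_opp nabc c0); apply/eqP.
    by apply/asboolP/asboolP => /popp_eq0.
  apply/and3P; split; apply: key => //.
    by apply/pnull23/pnull12.
  by apply/pnull23.
- apply/eqP; apply/asboolP/asboolP; first by move/pfun_eq0.
  by move/pfun_eq0.
Qed.

Lemma crel_zero x : czero x -> crel (JE (Tg x) T0).
Proof. by case: x => i x /asboolP /= ->; apply: crel0. Qed.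

Lemma colimit_exists : exists L (c : cocone D L), is_colimit c.
Proof.
pose L := presented crel_valid crel_zero.
pose inj0 i (x : D i) : L := pgen crel_valid crel_zero (existT _ i x).
have inj_0 i : inj0 i 0 = 0 by apply/pgen_eq/crel0.
have inj_1 i : inj0 i 1 = 1 by apply/pgen_eq/crel1.
have inj_M i x y : inj0 i (x * y) = inj0 i x * inj0 i y.
  by rewrite /= qmulE; apply/pgen_eq/crelM.
have inj_N i x y z : pnull x y z -> pnull (inj0 i x) (inj0 i y) (inj0 i z).
  by move=> n; apply/pgen_null/crelN.
pose inj i := PMorph (inj_0 i) (inj_1 i) (inj_M i) (inj_N i).
have injP i j (h : dhom i j) x : inj j (dmap h x) = inj i x.
  exact/pgen_eq/crelh.
exists L, (Cocone injP) => P k.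
have gu (x : X) : ~~ czero x -> k _ (tagged x) <> 0.
  by move=> nx /pfun_eq0 /asboolP; apply/negP.
have gR j : crel j -> jholds (fun x : X => k _ (tagged x)) j.
  case=> {j} /= [i|i|i x y|i x y z n|i j h x].
  - exact: pfun0.
  - exact: pfun1.
  - exact: pfunM.
  - exact: pfun_null.
  - exact: cinjP.
have [f fE] := presented_rec crel_valid crel_zero gu gR.
exists f; split=> [i x|g gE]; first exact: fE.
by apply/pmorph_eq/presented_ext => -[i x]; rewrite fE; apply: gE.
Qed.

End ColimitExists.

Definition colim (D : diagram) : pasture := sval (cid (colimit_exists D)).

Definition colim_in (D : diagram) : cocone D (colim D) :=
  sval (cid (svalP (cid (colimit_exists D)))).

Lemma colimP (D : diagram) : is_colimit (colim_in D).
Proof. exact: svalP (cid (svalP (cid (colimit_exists D)))). Qed.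

Definition colim_rec (D : diagram) (P : pasture) (k : cocone D P) :
  pmorph (colim D) P := sval (cid (colimP k)).

Lemma colim_recE (D : diagram) (P : pasture) (k : cocone D P) i x :
  colim_rec k (colim_in D i x) = k i x.
Proof. by rewrite /colim_rec; case: cid => f []. Qed.
(** * Matroids

The ground set is a subset of a finite type, so that all embedded minors of a
matroid live on the same type. *)

Record matroid (T : finType) := Matroid {
  ground : {set T};
  bases : {set {set T}};
  bases_ground : forall B, B \in bases -> B \subset ground;
  bases_neq0 : exists B, B \in bases;
  bases_exch : forall B1 B2 x, B1 \in bases -> B2 \in bases ->
    x \in B1 :\: B2 -> exists2 y, y \in B2 :\: B1 & y |: (B1 :\ x) \in bases }.

(** The subtypes are needed for the relation to be symmetric: a function
between the ambient types need not exist when one of them is empty. *)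
Definition miso (T T' : finType) (M : matroid T) (M' : matroid T') : Prop :=
  exists f : {x | x \in ground M} -> {x | x \in ground M'},
    bijective f /\
    forall A : {set {x | x \in ground M}},
      (val @: A \in bases M) = (val @: (f @: A) \in bases M').

Definition mindep (T : finType) (M : matroid T) (A : {set T}) : bool :=
  [exists B in bases M, A \subset B].

Definition mcoindep (T : finType) (M : matroid T) (A : {set T}) : bool :=
  (A \subset ground M) && [exists B in bases M, [disjoint A & B]].

Definition ordered_basis (T : finType) (M : matroid T) (s : seq T) : bool :=
  uniq s && ([set x in s] \in bases M).

Lemma perm_swap (T : eqType) (s1 s2 s3 : seq T) x y :
  perm_eq (s1 ++ x :: s2 ++ y :: s3) (s1 ++ y :: s2 ++ x :: s3).
Proof.
rewrite perm_cat2l; apply/permP => a; rewrite /= !count_cat /=.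
by rewrite addnCA [RHS]addnCA; congr addn; rewrite addnCA.
Qed.

Section MatroidTheory.
Variables (T : finType) (M : matroid T).
Implicit Types (A B : {set T}) (s : seq T).

Lemma card_bases_le B1 B2 :
  B1 \in bases M -> B2 \in bases M -> #|B1| <= #|B2|.
Proof.
move: {2}#|_| (leqnn #|B1 :\: B2|) => n.
elim: n B1 => [|n IHn] B1 leB bB1 bB2.
  by apply/subset_leq_card; rewrite -setD_eq0 -cards_eq0 -leqn0.
have [E|[x xB]] := set_0Vmem (B1 :\: B2).
  by apply/subset_leq_card; rewrite -setD_eq0 E.
have [y yB bB'] := bases_exch bB1 bB2 xB.
have [xB1 xB2] := setDP xB; have [yB2 yB1] := setDP yB.
have cB' : #|y |: (B1 :\ x)| = #|B1|.
  by rewrite cardsU1 !inE (negbTE yB1) andbF add1n [RHS](cardsD1 x) xB1.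
rewrite -cB'; apply: IHn => //; rewrite -ltnS; apply: leq_trans leB.
rewrite [X in _ < X](cardsD1 x) xB add1n ltnS; apply: subset_leq_card.
apply/subsetP => z; rewrite !inE => /andP[nz /orP[/eqP E|/andP[zx zB1]]].
  by rewrite E yB2 in nz.
by rewrite zx nz zB1.
Qed.

Lemma card_bases B1 B2 : B1 \in bases M -> B2 \in bases M -> #|B1| = #|B2|.
Proof. by move=> b1 b2; apply/eqP; rewrite eqn_leq !card_bases_le. Qed.

Lemma basis_extend A B : mindep M A -> B \in bases M ->
  exists2 B', B' \in bases M & (A \subset B') && (B' \subset A :|: B).
Proof.
case/exists_inP => B1 bB1 AB1 bB.
move: {2}#|_| (leqnn #|B1 :\: (A :|: B)|) => n.
elim: n B1 bB1 AB1 => [|n IHn] B1 bB1 AB1 leB.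
  by exists B1; rewrite // AB1 -setD_eq0 -cards_eq0 -leqn0.
have [E|[x]] := set_0Vmem (B1 :\: (A :|: B)).
  by exists B1; rewrite // AB1 -setD_eq0 E eqxx.
rewrite !inE negb_or -andbA => /and3P[xA xB xB1].
have xD : x \in B1 :\: B by rewrite inE xB.
have [y /setDP[yB yB1] bB'] := bases_exch bB1 bB xD.
apply: (IHn _ bB').
  apply/subsetP => z zA; rewrite !inE (subsetP AB1 _ zA) andbT orbC.
  by case: eqP zA xA => [->->|].
rewrite -ltnS; apply: leq_trans leB; apply: proper_card.
apply/properP; split.
  apply/subsetP => z; rewrite !inE.
  by case: (z =P y) => [->|_]; rewrite ?yB ?orbT //= => /and3P[-> _ ->].
exists x; first by rewrite !inE (negbTE xA) (negbTE xB).
rewrite !inE eqxx orbF (negbTE xA) (negbTE xB) /=.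
by apply: contraNN xB => /eqP->.
Qed.

Lemma ordered_basis_perm s s' :
  perm_eq s s' -> ordered_basis M s = ordered_basis M s'.
Proof.
move=> ss'; rewrite /ordered_basis (perm_uniq ss').
suff -> : [set x in s] = [set x in s'] by [].
by apply/setP => x; rewrite !inE (perm_mem ss').
Qed.

Lemma ordered_basis_enum B : ordered_basis M (enum B) = (B \in bases M).
Proof.
rewrite /ordered_basis enum_uniq; suff -> : [set x in enum B] = B by [].
by apply/setP => x; rewrite inE mem_enum.
Qed.

Lemma ordered_basis_swap s1 s2 s3 x y :
  ordered_basis M (s1 ++ x :: s2 ++ y :: s3)
    = ordered_basis M (s1 ++ y :: s2 ++ x :: s3).
Proof.
exact/ordered_basis_perm/perm_swap.
Qed.

Lemma ordered_basis_exch a b c d s :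
  ordered_basis M [:: a, b & s] -> ordered_basis M [:: c, d & s] ->
  ordered_basis M [:: a, c & s] || ordered_basis M [:: a, d & s].
Proof.
move=> oab ocd; have /andP[uab bab] := oab; have /andP[ucd bcd] := ocd.
have [bin|bnin] := boolP (b \in [:: c, d & s]).
  move: bin; rewrite !inE => /or3P[/eqP<-|/eqP<-|bs]; rewrite ?oab ?orbT //.
  by move: uab; rewrite /= bs andbF.
have [|y] := bases_exch bab bcd (x := b).
  by rewrite !inE in bnin *; rewrite bnin eqxx orbT.
rewrite !inE !negb_or => /andP[/and3P[ya yb ys] ycd] by'.
suff oay : ordered_basis M [:: a, y & s].
  by case/or3P: ycd ys oay => [/eqP->|/eqP->|->] // _ ->; rewrite ?orbT.
move: uab; rewrite /= !inE negb_or => /andP[/andP[nab nas] /andP[nbs us]].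
rewrite /ordered_basis /= !inE negb_or eq_sym ya nas ys us /=.
suff <- : y |: ([set x in [:: a, b & s]] :\ b) = [set x in [:: a, y & s]] by [].
apply/setP => z; rewrite !inE.
case: (z =P y) => [_|_] /=; first by rewrite orbT.
case: (z =P b) => [->|_] //=; rewrite ?(negbTE nbs) orbF.
by rewrite eq_sym (negbTE nab).
Qed.

Lemma ordered_basis_plucker a b c d s :
  ordered_basis M [:: a, b & s] -> ordered_basis M [:: c, d & s] ->
  ordered_basis M [:: a, c & s] && ordered_basis M [:: b, d & s]
  || ordered_basis M [:: a, d & s] && ordered_basis M [:: b, c & s].
Proof.
have sw x y := ordered_basis_swap [::] [::] s x y.
move=> ab cd; have ba : ordered_basis M [:: b, a & s] by rewrite sw.
have dc : ordered_basis M [:: d, c & s] by rewrite sw.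
have := ordered_basis_exch ab cd; have := ordered_basis_exch ba cd.
have := ordered_basis_exch cd ab; have := ordered_basis_exch dc ab.
rewrite !(sw c) !(sw d) /=.
by do 4!case: (ordered_basis _ _).
Qed.

End MatroidTheory.

(** * Representations *)

(** A function [E^r -> P] that vanishes off the ordered bases is extended by
zero to all sequences over the ambient type; the rank [r] and the ground set
[E] are then determined by [repr_supp]. *)
Record is_repr (T : finType) (M : matroid T) (P : pasture) (D : seq T -> P) :
    Prop := IsRepr {
  repr_supp : forall s, D s <> 0 <-> ordered_basis M s;
  repr_alt : forall s1 s2 s3 x y,
    D (s1 ++ x :: s2 ++ y :: s3) = - D (s1 ++ y :: s2 ++ x :: s3);
  repr_plucker : forall a b c d s,
    pnull (D [:: a, b & s] * D [:: c, d & s])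
          (- (D [:: a, c & s] * D [:: b, d & s]))
          (D [:: a, d & s] * D [:: b, c & s]) }.

Definition rescaling (T : Type) (P : pasture) (D D' : seq T -> P) : Prop :=
  exists (c : P) (d : T -> P), [/\ c <> 0, forall x, d x <> 0
    & forall s, D' s = c * \big[@pmul P/1]_(x <- s) d x * D s].

(** [F] represents the functor of rescaling classes of representations, with
universal element the class of [U]. *)
Definition is_foundation (T : finType) (M : matroid T) (F : pasture)
    (U : seq T -> F) : Prop :=
  is_repr M U /\
  forall (P : pasture) (D : seq T -> P), is_repr M D ->
    exists f : pmorph F P, rescaling (f \o U) D /\
    forall g : pmorph F P, rescaling (g \o U) D -> g = f.

Section RescalingTheory.
Variables (T : Type) (P : pasture).
Implicit Types D : seq T -> P.

Lemma rescaling_refl D : rescaling D D.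
Proof.
exists 1, (fun=> 1); split=> [|x|s]; do ?exact: pone_neq0.
by rewrite big1 // !pmul1.
Qed.

Lemma rescaling_trans D1 D2 D3 :
  rescaling D1 D2 -> rescaling D2 D3 -> rescaling D1 D3.
Proof.
move=> [c [d [nc nd E]]] [c' [d' [nc' nd' E']]].
exists (c * c'), (fun x => d x * d' x); split=> [|x|s].
- exact: pmul_neq0.
- exact: pmul_neq0.
rewrite E' E big_split /= pmulA; congr (_ * _).
by rewrite pmulACA [c' * c]pmulC; congr (_ * _); rewrite pmulC.
Qed.

Lemma rescaling_sym D1 D2 : rescaling D1 D2 -> rescaling D2 D1.
Proof.
move=> [c [d [nc nd E]]].
exists (pinv c), (fun x => pinv (d x)); split=> [|x|s].
- exact: pinv_neq0.
- exact: pinv_neq0.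
rewrite E pmulA -[LHS]pmul1; congr (_ * _); apply/esym.
rewrite pmulACA [pinv c * c]pmulC pmulxV // pmul1.
by rewrite -big_split big1 //= => x _; rewrite pmulC pmulxV.
Qed.

Lemma rescaling_eq D1 D2 : D1 =1 D2 -> rescaling D1 D2.
Proof. by move=> /funext->; apply: rescaling_refl. Qed.

End RescalingTheory.

Lemma rescaling_morph (T : Type) (P Q : pasture) (f : pmorph P Q)
  (D D' : seq T -> P) : rescaling D D' -> rescaling (f \o D) (f \o D').
Proof.
move=> [c [d [nc nd E]]]; exists (f c), (f \o d); split=> [|x|s] /=.
- exact: pfun_neq0.
- exact: pfun_neq0.
- by rewrite E !pfunM pfun_prod.
Qed.

Lemma repr_morph (T : finType) (M : matroid T) (P Q : pasture)
  (f : pmorph P Q) (D : seq T -> P) : is_repr M D -> is_repr M (f \o D).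
Proof.
case=> Ds Da Dp; split=> [s|s1 s2 s3 x y|a b c d s] /=.
- by rewrite -Ds; split=> nz; [move/pfun_eq0|apply: pfun_neq0].
- by rewrite Da pfunN.
- by rewrite -!pfunM -pfunN; apply: pfun_null.
Qed.

(** * Existence of foundations

Generators are the values of the universal representation; those on a suitable
set [S] of ordered bases are normalised to [1]. *)

Lemma forest (T : finType) (l : seq (T * T)) :
  exists S : seq (T * T), [/\ {subset S <= l},
    forall (P : pasture) (v : T * T -> P), (forall e, v e <> 0) ->
      exists2 d : T -> P, forall x, d x <> 0 &
        forall e, e \in S -> d e.2 = v e * d e.1
  & forall (P : pasture) (d : T -> P),
      (forall e, e \in S -> d e.1 = d e.2) ->
      forall e, e \in l -> d e.1 = d e.2].
Proof.
elim: l => [|[x0 y0] l [S [Sl Sv Sd]]].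
  by exists [::]; split=> // P v _; exists (fun=> 1) => // _; apply: pone_neq0.
pose r := [rel x y | ((x, y) \in S) || ((y, x) \in S)].
have r_sym : connect_sym r by apply: sym_connect_sym => x y /=; rewrite orbC.
have [con|ncon] := boolP (connect r y0 x0).
  exists S; split=> // [e /Sl|P d dS e]; first by rewrite inE orbC => ->.
  rewrite inE => /predU1P[->|]; last exact: Sd.
  have {}con : connect r x0 y0 by rewrite r_sym.
  case/connectP: con => p /=; elim: p x0 => /= [x _ ->//|z p IHp x].
  by case/andP=> /orP[/dS|/dS] /= xz pz /(IHp _ pz) <-.
exists ((x0, y0) :: S); split=> [e|P v nv|P d dS e].
- by rewrite !inE => /orP[->//|/Sl->]; rewrite orbT.
- have [d nd dS] := Sv P v nv.
  pose k := v (x0, y0) * d x0 * pinv (d y0).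
  have nk : k <> 0.
    by do ?apply: pmul_neq0; do ?exact: pinv_neq0.
  exists (fun z => if connect r y0 z then k * d z else d z) => [x|e].
    by case: ifP => // _; apply: pmul_neq0.
  rewrite inE => /predU1P[->|eS] /=.
    rewrite connect0 (negbTE ncon) -!pmulA [pinv _ * _]pmulC pmulxV //.
    by rewrite pmul1r.
  have -> : connect r y0 e.1 = connect r y0 e.2.
    apply: (same_connect_r r_sym); apply: connect1.
    by rewrite /= -surjective_pairing eS.
  by case: ifP => _; rewrite dS // pmulCA.
- rewrite inE => /predU1P[->|]; first by rewrite dS ?mem_head.
  by apply: Sd => f fS; apply: dS; rewrite inE fS orbT.
Qed.

Section NormalisingSet.
Variables (T : finType) (M : matroid T).

Lemma fundamental_edges (P : pasture) (B0 : {set T}) (d : T -> P) :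
  B0 \in bases M ->
  (forall b x, b \in B0 -> x \notin B0 -> x |: (B0 :\ b) \in bases M ->
     d b = d x) ->
  forall B, B \in bases M ->
    \big[@pmul P/1]_(x in B) d x = \big[@pmul P/1]_(x in B0) d x.
Proof.
move=> bB0 dE B; move: {2}#|_| (leqnn #|B :\: B0|) => n.
elim: n B => [|n IHn] B leB bB.
  have BB0 : B \subset B0 by rewrite -setD_eq0 -cards_eq0 -leqn0.
  by have /eqP-> : B == B0 by rewrite eqEcard BB0 (card_bases_le bB0 bB).
have [E|[e /setDP[eB eB0]]] := set_0Vmem (B :\: B0).
  have BB0 : B \subset B0 by rewrite -setD_eq0 E.
  by have /eqP-> : B == B0 by rewrite eqEcard BB0 (card_bases_le bB0 bB).
pose A := [set b in B0 | `[< d b = d e >]].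
have AB0 : A \subset B0 by apply/subsetP => b; rewrite inE => /andP[].
have iA : mindep M A by apply/exists_inP; exists B0.
have niAe : ~~ mindep M (e |: A).
  apply/negP => /basis_extend /(_ bB0) [B2 bB2 /andP[]].
  rewrite subUset sub1set => /andP[eB2 AB2] B2B0.
  have /subsetPn[b bB0' bB2'] : ~~ (B0 \subset B2).
    apply/negP => B0B2; have : e |: B0 \subset B2.
      by rewrite subUset sub1set eB2.
    by move/subset_leq_card; rewrite cardsU1 eB0 (card_bases bB2 bB0) ltnn.
  have B2E : B2 = e |: (B0 :\ b).
    apply/eqP; rewrite eqEcard cardsU1 !inE (negbTE eB0) andbF add1n.
    rewrite (card_bases bB2 bB0) [#|B0|](cardsD1 b) bB0' add1n leqnn andbT.
    apply/subsetP => z zB2; have := subsetP B2B0 _ zB2.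
    rewrite !inE -orbA; case: (z =P e) => //= _.
    have -> /= : z != b by apply: contraNN bB2' => /eqP<-.
    by case/orP => // /andP[].
  have db : d b = d e by apply: dE => //; rewrite -B2E.
  by case/negP: bB2'; apply: (subsetP AB2); rewrite inE bB0'; apply/asboolP.
have [B1 bB1 /andP[AB1 B1AB]] := basis_extend iA bB.
have eB1 : e \notin B1.
  apply: contraNN niAe => eB1; apply/exists_inP; exists B1 => //.
  by rewrite subUset sub1set eB1.
have [|b /setDP[bB1' bB'] bBb] := bases_exch bB bB1 (x := e).
  by rewrite inE eB1.
have : b \in A by have := subsetP B1AB _ bB1'; rewrite inE (negbTE bB') orbF.
rewrite inE => /andP[bB0' /asboolP dbe].
rewrite -(IHn _ _ bBb).
  rewrite (big_setD1 e) //= big_setU1 ?dbe //.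
  by rewrite !inE (negbTE bB') andbF.
rewrite -ltnS; apply: leq_trans leB; apply: proper_card.
apply/properP; split.
  apply/subsetP => z; rewrite !inE.
  by case: (z =P b) => [->|_]; rewrite ?bB0' //= => /and3P[-> _ ->].
exists e; rewrite !inE ?eB0 // eqxx /= orbF.
by apply: contraNN bB' => /eqP<-.
Qed.

Lemma normalising_set : exists S : seq (seq T),
  [/\ forall s, s \in S -> ordered_basis M s,
    forall (P : pasture) (D : seq T -> P), is_repr M D ->
      exists2 D' : seq T -> P, rescaling D D' & forall s, s \in S -> D' s = 1
  & forall (P : pasture) (c : P) (d : T -> P), c <> 0 -> (forall x, d x <> 0) ->
      (forall s, s \in S -> c * \big[@pmul P/1]_(x <- s) d x = 1) ->
      forall s, ordered_basis M s -> c * \big[@pmul P/1]_(x <- s) d x = 1].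
Proof.
have [B0 bB0] := bases_neq0 M.
pose s0 := enum B0; have us0 : uniq s0 := enum_uniq _.
pose se (e : T * T) := e.2 :: rem e.1 s0.
pose l := [seq e <- enum {: T * T} | [&& e.1 \in B0, e.2 \notin B0
                                       & e.2 |: (B0 :\ e.1) \in bases M]].
have lP e : (e \in l) =
    [&& e.1 \in B0, e.2 \notin B0 & e.2 |: (B0 :\ e.1) \in bases M].
  by rewrite mem_filter mem_enum andbT.
have ose e : e \in l -> ordered_basis M (se e).
  rewrite lP => /and3P[e1 e2 be]; rewrite /ordered_basis /= rem_uniq // andbT.
  apply/andP; split.
    by apply: contraNN e2 => /mem_rem; rewrite mem_enum.
  suff <- : e.2 |: (B0 :\ e.1) = [set x in se e] by [].
  apply/setP => z.
  by rewrite !inE mem_rem_uniq // inE mem_enum.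
have [S [Sl Sv Sd]] := forest l.
have pse (P : pasture) (d : T -> P) e : e \in l ->
    d e.1 * \big[@pmul P/1]_(x <- se e) d x
    = d e.2 * \big[@pmul P/1]_(x <- s0) d x.
  rewrite lP => /and3P[e1 _ _].
  have e1s : e.1 \in s0 by rewrite mem_enum.
  by rewrite (perm_big _ (perm_to_rem e1s)) !big_cons pmulCA.
exists (s0 :: [seq se e | e <- S]); split.
- move=> s; rewrite inE => /predU1P[->|/mapP[e /Sl el ->]]; last exact: ose.
  by rewrite ordered_basis_enum.
- move=> P D [Ds _ _].
  have nD s : ordered_basis M s -> D s <> 0 by move/Ds.
  have nD0 : D s0 <> 0 by apply: nD; rewrite ordered_basis_enum.
  pose v e := if e \in l then D s0 * pinv (D (se e)) else 1.
  have nv e : v e <> 0.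
    rewrite /v; case: ifP => [/ose/nD ne|_]; last exact: pone_neq0.
    by apply: pmul_neq0 => //; apply: pinv_neq0.
  have [d nd dS] := Sv P v nv.
  pose c := pinv (\big[@pmul P/1]_(x <- s0) d x * D s0).
  have npr s : \big[@pmul P/1]_(x <- s) d x <> 0 by apply: pprod_neq0.
  have n0 : \big[@pmul P/1]_(x <- s0) d x * D s0 <> 0 by apply: pmul_neq0.
  have nc : c <> 0 by apply: pinv_neq0.
  exists (fun s => c * \big[@pmul P/1]_(x <- s) d x * D s); first by exists c, d.
  move=> s; rewrite inE => /predU1P[->|/mapP[e eS ->]].
    by rewrite -pmulA pmulC pmulxV.
  rewrite -pmulA; suff -> : \big[@pmul P/1]_(x <- se e) d x * D (se e)
    = \big[@pmul P/1]_(x <- s0) d x * D s0 by rewrite pmulC pmulxV.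
  have el := Sl _ eS; apply: (pmulI (nd e.1)); rewrite pmulA pse // dS //.
  rewrite /v el; have := pmulxV (nD _ (ose _ el)).
  set X := D (se e); set Y := \big[_/_]_(_ <- _) _ => XE.
  rewrite -!pmulA [Y * X]pmulC [d e.1 * (X * _)]pmulCA [pinv X * _]pmulA.
  by rewrite [pinv X * X]pmulC XE pmul1 pmulC -pmulA.
- move=> P c d nc nd dS.
  have E0 : c * \big[@pmul P/1]_(x <- s0) d x = 1 by apply: dS; rewrite mem_head.
  have dE e : e \in S -> d e.1 = d e.2.
    move=> eS; have Ee : c * \big[@pmul P/1]_(x <- se e) d x = 1.
      by apply: dS; rewrite inE map_f ?orbT.
    have := pse P d e (Sl _ eS) => /(congr1 (pmul c)).
    by rewrite !(pmulCA c) Ee E0 !pmul1r.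
  have {}dE b x : b \in B0 -> x \notin B0 -> x |: (B0 :\ b) \in bases M ->
      d b = d x.
    move=> bB xB bx; apply: (Sd P d dE (b, x)).
    by rewrite lP bB xB bx.
  move=> s /andP[us bs]; rewrite -[RHS]E0; congr (_ * _).
  rewrite !big_uniq //=.
  transitivity (\big[@pmul P/1]_(x in B0) d x).
    rewrite -[RHS](fundamental_edges bB0 dE bs).
    by apply: eq_bigl => x; rewrite inE.
  by apply: eq_big => // x; rewrite mem_enum.
Qed.

End NormalisingSet.

Section FoundationExists.
Variables (T : finType) (M : matroid T).
Variable S : seq (seq T).
Hypothesis S_basis : forall s, s \in S -> ordered_basis M s.

Inductive frel : pjudg (seq T) -> Prop :=
  | frel0 s : ~~ ordered_basis M s -> frel (JE (Tg s) T0)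
  | frel_alt s1 s2 s3 x y :
      frel (JE (Tg (s1 ++ x :: s2 ++ y :: s3))
               (To (Tg (s1 ++ y :: s2 ++ x :: s3))))
  | frel_plucker a b c d s :
      frel (JN (Tm (Tg [:: a, b & s]) (Tg [:: c, d & s]))
               (To (Tm (Tg [:: a, c & s]) (Tg [:: b, d & s])))
               (Tm (Tg [:: a, d & s]) (Tg [:: b, c & s])))
  | frel_norm s : s \in S -> frel (JE (Tg s) T1).

Definition fzero (s : seq T) : bool := ~~ ordered_basis M s.

Lemma frel_valid j : frel j -> jvalid fzero j.
Proof.
rewrite /fzero; case=> {j} /= [s|s1 s2 s3 x y|a b c d s|s /S_basis->] //.
- by move->.
- by rewrite ordered_basis_swap.
rewrite -!negb_and; have sw := @ordered_basis_swap _ M [::] [::] s.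
have := @ordered_basis_plucker _ M a b c d s.
have := @ordered_basis_plucker _ M a c b d s.
have := @ordered_basis_plucker _ M a d b c s.
rewrite (sw d b) (sw c b) (sw d c) /=.
do 6!case: (ordered_basis M _) => //=; move=> H1 H2 H3.
all: by [apply: H1 | apply: H2 | apply: H3].
Qed.

Lemma frel_zero s : fzero s -> frel (JE (Tg s) T0).
Proof. exact: frel0. Qed.

Definition fpres : pasture := presented frel_valid frel_zero.
Definition funiv (s : seq T) : fpres := pgen frel_valid frel_zero s.

Lemma funiv_repr : is_repr M funiv.
Proof.
split=> [s|s1 s2 s3 x y|a b c d s].
- split=> [nz|os]; last by move=> /qcls_eq/(der_valid frel_valid)/=;
    rewrite /fzero os.
  by have [//|ns] := boolP (ordered_basis M s); case: nz; apply/pgen_eq/frel0.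
- by rewrite /= qoppE; apply/pgen_eq/frel_alt.
- rewrite /= !qmulE qoppE; apply: pgen_null; last exact: frel_plucker.
    exact: frel_valid.
  exact: frel_zero.
Qed.

Lemma funiv_rec (P : pasture) (D : seq T -> P) : is_repr M D ->
  (forall s, s \in S -> D s = 1) ->
  exists f : pmorph fpres P, forall s, f (funiv s) = D s.
Proof.
move=> [Ds Da Dp] DS; apply: presented_rec => [s|j].
  by rewrite /fzero negbK => /Ds.
case=> {j} /= [s ns|s1 s2 s3 x y|a b c d s|s /DS] //.
by case: (pselect (D s = 0)) => // /Ds os; rewrite os in ns.
Qed.

Lemma funiv_norm s : s \in S -> funiv s = 1.
Proof. by move=> sS; apply/pgen_eq/frel_norm. Qed.

End FoundationExists.

Lemma repr_rescaling (T : finType) (M : matroid T) (P : pasture)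
  (D D' : seq T -> P) : is_repr M D -> rescaling D D' -> is_repr M D'.
Proof.
move=> [Ds Da Dp] [c [d [nc nd E]]].
pose w s := c * \big[@pmul P/1]_(x <- s) d x.
have nw s : w s <> 0 by apply: pmul_neq0 => //; apply: pprod_neq0.
have wp s s' : perm_eq s s' -> w s = w s'.
  by move=> ss'; rewrite /w (perm_big _ ss').
split=> [s|s1 s2 s3 x y|a b e f s].
- rewrite -Ds E; split=> nz; last exact: (pmul_neq0 (nw s)).
  by move=> D0; apply: nz; rewrite D0 pmul0r.
- rewrite !E -pmulrN -Da; congr (_ * _).
  exact/wp/perm_swap.
- pose W := c * c * (d a * d b * d e * d f)
    * (\big[@pmul P/1]_(x <- s) d x * \big[@pmul P/1]_(x <- s) d x).
  have key x y z t : perm_eq [:: x; y; z; t] [:: a; b; e; f] ->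
      D' [:: x, y & s] * D' [:: z, t & s] =
      W * (D [:: x, y & s] * D [:: z, t & s]).
    move=> pe; rewrite !E !big_cons /W.
    have -> : d a * d b * d e * d f = d x * d y * (d z * d t).
      transitivity (\big[@pmul P/1]_(i <- [:: a; b; e; f]) d i).
        by rewrite !big_cons big_nil !pmul1r !pmulA.
      rewrite -(perm_big _ pe) /= !big_cons big_nil -!pmulA; do 3!congr (_ * _).
      by rewrite pmul1r.
    rewrite pmulACA; congr (_ * _); rewrite pmulACA -[RHS]pmulA.
    by congr (_ * _); rewrite !(pmulA (d _) (d _)) pmulACA.
  rewrite !key //; first by rewrite -pmulrN; apply/pnullM.
  - by apply/permP => q /=; rewrite !addn0; congr addn; rewrite addnC addnA.
  - by apply/permP => q /=; rewrite !addn0; congr addn; rewrite addnCA.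
Qed.

Lemma foundation_exists (T : finType) (M : matroid T) :
  exists (F : pasture) (U : seq T -> F), is_foundation M U.
Proof.
have [S [Sb Sn Su]] := normalising_set M.
exists (fpres Sb), (funiv Sb); split; first exact: funiv_repr.
move=> P D rD; have [D' DD' D'1] := Sn P D rD.
have [f fE] := funiv_rec Sb (repr_rescaling rD DD') D'1.
have fD' : f \o funiv Sb = D' by apply/funext.
exists f; split; first by rewrite fD'; apply: rescaling_sym.
move=> g /rescaling_trans /(_ DD') [c [d [nc nd gD']]].
apply/pmorph_eq/presented_ext => s; change (g (funiv Sb s) = f (funiv Sb s)).
have [os|ns] := boolP (ordered_basis M s); last first.
  have -> : funiv Sb s = 0 by apply/pgen_eq/frel0.
  by rewrite !pfun0.
rewrite fE gD' Su ?pmul1 // => s' s'S.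
by have := gD' s'; rewrite /= funiv_norm // pfun1 pmul1r D'1.
Qed.

Definition foundation (T : finType) (M : matroid T) : pasture :=
  sval (cid (foundation_exists M)).

Definition univ_repr (T : finType) (M : matroid T) : seq T -> foundation M :=
  sval (cid (svalP (cid (foundation_exists M)))).

Lemma foundationP (T : finType) (M : matroid T) :
  is_foundation M (@univ_repr T M).
Proof. exact: svalP (cid (svalP (cid (foundation_exists M)))). Qed.

(** * Embedded minors *)

Record emb_minor (T : finType) (M : matroid T) := EmbMinor {
  mctr : {set T};
  mdel : {set T};
  mctr_del : [disjoint mctr & mdel];
  mctr_indep : mindep M mctr;
  mdel_coindep : mcoindep M mdel }.

Section Minor.
Variables (T : finType) (M : matroid T) (p : emb_minor M).
Local Notation I := (mctr p).
Local Notation J := (mdel p).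

Definition minor_ground : {set T} := ground M :\: (I :|: J).

Definition minor_bases : {set {set T}} :=
  [set B : {set T} | (B \subset minor_ground) && (B :|: I \in bases M)].

Lemma minor_bases_ground B : B \in minor_bases -> B \subset minor_ground.
Proof. by rewrite inE => /andP[]. Qed.

Lemma minor_bases_neq0 : exists B, B \in minor_bases.
Proof.
have /andP[_ /exists_inP[B0 bB0 dJ]] := mdel_coindep p.
have [B bB /andP[IB BIB]] := basis_extend (mctr_indep p) bB0.
exists (B :\: I); rewrite inE setUC; apply/andP; split; last first.
  suff -> : I :|: (B :\: I) = B by [].
  apply/setP => x; rewrite !inE; case: (boolP (x \in I)) => //= xI.
  by rewrite (subsetP IB).
apply/subsetP => x; rewrite !inE => /andP[xI xB].
rewrite negb_or xI (subsetP (bases_ground bB)) // andbT /=.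
have := subsetP BIB _ xB; rewrite inE (negbTE xI) /= => xB0.
by apply/negP => xJ; have := disjointFr dJ xJ; rewrite xB0.
Qed.

Lemma minor_bases_exch B1 B2 x : B1 \in minor_bases -> B2 \in minor_bases ->
  x \in B1 :\: B2 -> exists2 y, y \in B2 :\: B1 & y |: (B1 :\ x) \in minor_bases.
Proof.
rewrite !inE => /andP[B1g bB1] /andP[B2g bB2] /andP[xB2 xB1].
have gI (B : {set T}) z : B \subset minor_ground -> z \in B -> z \notin I.
  move=> Bg zB; have := subsetP Bg _ zB.
  by rewrite !inE negb_or => /andP[/andP[]].
have xI := gI _ _ B1g xB1.
have [|y yB bB] := bases_exch bB1 bB2 (x := x).
  by rewrite !inE negb_or xB2 xI xB1.
move: yB; rewrite !inE negb_or => /andP[/andP[yB1 yI]].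
rewrite (negbTE yI) orbF => yB2; exists y; first by rewrite inE yB1.
rewrite inE; apply/andP; split.
  rewrite subUset sub1set (subsetP B2g) //=.
  exact: subset_trans (subsetDl _ _) B1g.
suff <- : y |: ((B1 :|: I) :\ x) = y |: (B1 :\ x) :|: I by [].
apply/setP => z; rewrite !inE -orbA; congr orb.
by case: (z =P x) => [->|//]; rewrite /= (negbTE xI).
Qed.

Definition minor : matroid T :=
  Matroid minor_bases_ground minor_bases_neq0 minor_bases_exch.

End Minor.

Definition proper_minor (T : finType) (M : matroid T) (p : emb_minor M) : Prop :=
  ~ (mctr p = set0 /\ mdel p = set0).

(** [N = M \ J / I] for [J = ground M :\: ground N :\: I]; as [N] has a basis,
[I] is then independent and [J] coindependent in [M]. *)
Definition minor_emb (T : finType) (N M : matroid T) (I : {set T}) : Prop :=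
  [/\ ground N \subset ground M, [disjoint I & ground N]
    & forall B : {set T}, B \subset ground N ->
        (B \in bases N) = (B :|: I \in bases M)].

Definition restr (T : finType) (N : matroid T) (P : pasture) (I : {set T})
    (D : seq T -> P) (s : seq T) : P :=
  if all (mem (ground N)) s then D (s ++ enum I) else 0.

Lemma restr_repr (T : finType) (N M : matroid T) (I : {set T}) (P : pasture)
  (D : seq T -> P) : minor_emb N M I -> is_repr M D -> is_repr N (restr N I D).
Proof.
move=> [NM dI NE] [Ds Da Dp]; split=> [s|s1 s2 s3 x y|a b c d s].
- rewrite /restr; case: (boolP (all _ s)) => [/allP sN|nsN]; last first.
    split=> // /andP[_ /bases_ground /subsetP sN]; case/negP: nsN.
    by apply/allP => x xs; apply: sN; rewrite inE.
  rewrite Ds /ordered_basis cat_uniq enum_uniq andbT NE; last first.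
    by apply/subsetP => x; rewrite inE => /sN.
  have -> : has (mem s) (enum I) = false.
    apply/negP => /hasP[x]; rewrite mem_enum => xI /sN /=.
    by rewrite (disjointFr dI xI).
  rewrite andbT; suff -> : [set x in s ++ enum I] = [set x in s] :|: I by [].
  by apply/setP => x; rewrite !inE mem_cat mem_enum.
- rewrite /restr (perm_all _ (perm_swap s1 s2 s3 x y)).
  by case: ifP => _; rewrite ?popp0 // -!catA /= -!catA /= Da.
- rewrite /restr /=; set q := all _ s.
  case: (a \in ground N); case: (b \in ground N); case: (c \in ground N);
    case: (d \in ground N); case: q => /=;
    rewrite ?pmul0 ?pmul0r ?popp0 //; exact: pnull000.
Qed.

Definition restr_class_map (T : finType) (N M : matroid T) (I : {set T})
  (h : minor_emb N M I) := (foundationP N).2 _ _ (restr_repr h (foundationP M).1).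

(** The order in which [restr] appends [I] only matters up to sign, hence not for
rescaling classes. *)
Definition fnd_map (T : finType) (N M : matroid T) (I : {set T})
    (h : minor_emb N M I) : pmorph (foundation N) (foundation M) :=
  sval (cid (restr_class_map h)).

Lemma fnd_mapP (T : finType) (N M : matroid T) (I : {set T})
  (h : minor_emb N M I) :
  rescaling (fnd_map h \o @univ_repr T N) (restr N I (@univ_repr T M)).
Proof. by rewrite /fnd_map; case: cid => f []. Qed.

Lemma fnd_map_uniq (T : finType) (N M : matroid T) (I : {set T})
  (h : minor_emb N M I) (f : pmorph (foundation N) (foundation M)) :
  rescaling (f \o @univ_repr T N) (restr N I (@univ_repr T M)) ->
  f = fnd_map h.
Proof. exact: (svalP (cid (restr_class_map h))).2. Qed.

Section MinorEmbeddings.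
Variables (T : finType) (M : matroid T).
Implicit Types p q : emb_minor M.

Definition emb_le p q : Prop := mctr q \subset mctr p /\ mdel q \subset mdel p.

Lemma minor_emb_top p : minor_emb (minor p) M (mctr p).
Proof.
split=> [||B Bg]; first exact: subsetDl.
  rewrite disjoint_subset; apply/subsetP => x xI.
  by rewrite !inE negb_and negbK xI.
by rewrite inE Bg.
Qed.

Lemma emb_le_ctr p q : emb_le p q ->
  mctr p :\: mctr q \subset ground (minor q).
Proof.
move=> [_ qpJ]; apply/subsetP => x; rewrite !inE negb_or => /andP[xq xp].
have /exists_inP[B bB pB] := mctr_indep p.
rewrite xq (subsetP (bases_ground bB)) ?(subsetP pB) // andbT /=.
by apply/negP => /(subsetP qpJ) xJ; have := disjointFr (mctr_del p) xp;
   rewrite xJ.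
Qed.

Lemma minor_emb_le p q : emb_le p q ->
  minor_emb (minor p) (minor q) (mctr p :\: mctr q).
Proof.
move=> h; have [qpI qpJ] := h; have gpq : ground (minor p) \subset ground (minor q).
  by apply: setDS; apply: setUSS.
split=> // [|B Bg].
  rewrite disjoint_subset; apply/subsetP => x; rewrite !inE => /andP[_ xI].
  by rewrite negb_and negbK xI.
rewrite /minor /= !inE Bg /= -setUA.
have -> : mctr p :\: mctr q :|: mctr q = mctr p.
  by rewrite setUC; apply/setP => x; rewrite !inE;
     case: (boolP (x \in mctr q)) => //= /(subsetP qpI).
suff -> : B :|: mctr p :\: mctr q \subset ground (minor q) by [].
by rewrite subUset (subset_trans Bg gpq) emb_le_ctr.
Qed.

End MinorEmbeddings.

(** * The canonical morphisms *)

Lemma repr_perm (T : finType) (M : matroid T) (P : pasture) (D : seq T -> P)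
    (l l' : seq T) : is_repr M D -> perm_eq l l' ->
  exists2 e : P, e <> 0 & forall s, D (s ++ l) = e * D (s ++ l').
Proof.
move=> rD.
have mv x a b : exists2 e : P, e <> 0 &
    forall s, D (s ++ a ++ x :: b) = e * D (s ++ x :: a ++ b).
  elim: a => [|y a [e ne eE]].
    by exists 1; [apply: pone_neq0|move=> s; rewrite pmul1].
  exists (- e) => [/popp_eq0 //|s].
  rewrite /= -(cat_rcons y s) eE cat_rcons pmulNr -pmulrN; congr (_ * _).
  exact: (repr_alt rD s [::] (a ++ b) y x).
elim: l l' => [|x l IHl] l'.
  by rewrite perm_sym => /perm_nilP->; exists 1;
    [apply: pone_neq0|move=> s; rewrite pmul1].
move=> pl; have xl' : x \in l' by rewrite -(perm_mem pl) mem_head.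
case/splitPr: xl' pl => a b pl.
have {}pl : perm_eq l (a ++ b).
  by rewrite -(perm_cons x) (perm_trans pl) // -cat1s perm_catCA.
have [e ne eE] := IHl _ pl; have [e' ne' eE'] := mv x a b.
exists (e * pinv e') => [|s].
  by apply: pmul_neq0 => //; apply: pinv_neq0.
rewrite eE' -pmulA [pinv e' * _]pmulA [pinv e' * e']pmulC pmulxV // pmul1.
by rewrite -!(cat_rcons x s) eE.
Qed.

Lemma restr_rescaling (T : finType) (N : matroid T) (I : {set T})
    (P : pasture) (D D' : seq T -> P) :
  rescaling D D' -> rescaling (restr N I D) (restr N I D').
Proof.
move=> [c [d [nc nd E]]].
exists (c * \big[@pmul P/1]_(x <- enum I) d x), d; split=> // [|s].
  by apply: pmul_neq0 => //; apply: pprod_neq0.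
rewrite /restr; case: ifP => _; last by rewrite pmul0r.
by rewrite E big_cat /= -!pmulA; congr (_ * _); rewrite pmulCA.
Qed.

Lemma restr_morph (T : finType) (N : matroid T) (I : {set T})
    (P Q : pasture) (f : pmorph P Q) (D : seq T -> P) :
  f \o restr N I D = restr N I (f \o D).
Proof.
by apply/funext => s /=; rewrite /restr; case: ifP => _; rewrite ?pfun0.
Qed.

Section Omega.
Variables (T : finType) (M : matroid T).

Lemma fnd_map_comp (p q : emb_minor M) (h : emb_le p q) x :
  fnd_map (minor_emb_top q) (fnd_map (minor_emb_le h) x)
    = fnd_map (minor_emb_top p) x.
Proof.
set f := fnd_map (minor_emb_top q); set g := fnd_map _.
suff -> : fnd_map (minor_emb_top p) = pmorph_comp f g by [].
apply/esym/fnd_map_uniq.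
have gP := rescaling_morph f (fnd_mapP (minor_emb_le h)).
apply: rescaling_trans gP _; rewrite restr_morph.
apply: rescaling_trans (restr_rescaling _ _ (fnd_mapP (minor_emb_top q))) _.
have rM := (foundationP M).1.
have [|e ne eE] := @repr_perm _ _ _ _ (enum (mctr p))
  (enum (mctr p :\: mctr q) ++ enum (mctr q)) rM.
  apply: uniq_perm; rewrite ?cat_uniq ?enum_uniq ?andbT //=.
    by apply/hasP => -[y]; rewrite !mem_enum inE => -> /andP[].
  move=> y; rewrite mem_cat !mem_enum inE.
  by case: (boolP (y \in mctr q)) => [/(subsetP h.1)|]; rewrite ?orbF.
exists e, (fun=> 1); split=> // [y|s]; first exact: pone_neq0.
rewrite big1 // pmul1r /restr.
case: (boolP (all (mem (ground (minor p))) s)) => sp; last by rewrite pmul0r.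
rewrite eE catA; case: (boolP (all _ _)) => // /negP[].
rewrite all_cat; apply/andP; split; apply/allP => y.
  by move/(allP sp); apply/subsetP; case: (minor_emb_le h).
by rewrite mem_enum; apply/subsetP/emb_le_ctr.
Qed.

(** The diagram of foundations of the embedded minors satisfying [Q], with all
minor embeddings between them. *)
Definition fnd_diagram (Q : emb_minor M -> Prop) : diagram :=
  @Diagram {p | Q p} (fun p q => emb_le (sval p) (sval q))
    (fun p => foundation (minor (sval p)))
    (fun p q h => fnd_map (minor_emb_le h)).

Definition fnd_cocone (Q : emb_minor M -> Prop) :
    cocone (fnd_diagram Q) (foundation M) :=
  @Cocone (fnd_diagram Q) (foundation M)
    (fun p => fnd_map (minor_emb_top (sval p)))
    (fun p q h x => fnd_map_comp h x).

Definition canonical_morphism (Q : emb_minor M -> Prop) :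
    pmorph (colim (fnd_diagram Q)) (foundation M) :=
  colim_rec (fnd_cocone Q).

End Omega.

(** * Classes of matroids and fundamental types *)

(** A class of matroids closed under isomorphism; equivalently, a family of
isomorphism classes of matroids. *)
Record mclass := MClass {
  in_class :> forall T : finType, matroid T -> Prop;
  in_class_iso : forall (T T' : finType) (M : matroid T) (M' : matroid T'),
    miso M M' -> in_class M -> in_class M' }.

Definition subclass (C C' : mclass) : Prop :=
  forall (T : finType) (M : matroid T), C T M -> C' T M.

Definition eqclass (C C' : mclass) : Prop :=
  forall (T : finType) (M : matroid T), C T M <-> C' T M.

(** Every minor is of the form [M \ J / I] with [I] independent and [J]
coindependent. *)
Definition minor_closed (C : mclass) : Prop :=
  forall (T : finType) (M : matroid T) (p : emb_minor M),
    C T M -> C T (minor p).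

Definition Omega (C0 : mclass) (T : finType) (M : matroid T) :=
  canonical_morphism (fun p : emb_minor M => C0 T (minor p)).

Definition Omega_lt (C : mclass) (T : finType) (M : matroid T) :=
  canonical_morphism
    (fun p : emb_minor M => proper_minor p /\ C T (minor p)).

Definition determines_foundations (C C0 : mclass) : Prop :=
  forall (T : finType) (M : matroid T), C T M -> pis_iso (Omega C0 M).

Definition fundamental_type (C C0 : mclass) : Prop :=
  determines_foundations C C0 /\
  forall C1 : mclass,
    subclass C1 C0 -> determines_foundations C C1 -> subclass C0 C1.

(* Main.v *)
(** A canonical morphism is an isomorphism exactly when [foundation M] itself is
a colimit of the diagram. Colimits can be computed in two
steps: if every proper minor of [M] in [C] is a colimit of its own minors in
[C0], where [C0] is a subclass of [C] not containing [M], then the minors of [M]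
in [C0] and the proper minors of [M] in [C] have the same colimit
([Omega_notin]). By induction on the size of the ground set, the matroids of [C]
with [Omega_lt] not invertible determine all foundations, and conversely none
of them can be left out of a subclass of [C] that determines them. *)

Require Import Defs.
From mathcomp Require Import all_boot.
From mathcomp Require Import boolp.

Set Implicit Arguments.
Unset Strict Implicit.
Unset Printing Implicit Defensive.

Local Open Scope pasture_scope.

(** * Universal properties of colimits of pastures *)

Definition pmorph_id (P : pasture) : pmorph P P.
Proof. by exists id. Defined.

(** Colimits are unique up to isomorphism. This eliminates the chosen object [colim]: later
    arguments only compare cocones over foundations. *)
Lemma canonical_isoP (T : finType) (M : matroid T) (Q : emb_minor M -> Prop) :
  pis_iso (canonical_morphism Q) <-> is_colimit (fnd_cocone Q).
Proof.
set c := fnd_cocone Q; set f : pmorph _ _ := canonical_morphism Q.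
have fE i x : f (colim_in _ i x) = c i x by apply: colim_recE.
split=> [[g [fK gK]] P k|cl].
  have [u [uE uU]] := colimP k.
  exists (pmorph_comp u g); split=> [i x|v vE] /=; first by rewrite -fE fK.
  have <- : pmorph_comp v f = u by apply: uU => i x /=; rewrite fE.
  by apply: pmorph_eq => y /=; rewrite gK.
(* The inverse is the morphism mediating towards [colim]. Both composites mediate a colimit cocone
   to itself, so they are identities. *)
have [g [gE _]] := cl _ (colim_in (fnd_diagram Q)); exists g; split=> x.
  have [u [_ uU]] := colimP (colim_in (fnd_diagram Q)).
  have idu : pmorph_id _ = u by apply: uU.
  have gfu : pmorph_comp g f = u by apply: uU => i y /=; rewrite fE.
  by rewrite -[RHS]/(pmorph_id _ x) idu -gfu.
have [u [_ uU]] := cl _ c.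
have idu : pmorph_id _ = u by apply: uU.
have fgu : pmorph_comp f g = u by apply: uU => i y /=; rewrite gE fE.
by rewrite -[RHS]/(pmorph_id _ x) idu -fgu.
Qed.

(** A cocone over [D'] pulls back along [psi] and [kappa] to one over [D], and the last condition
    recovers its component at [i] from the one at [psi (phi i)]. Asking for an arrow from [i] to
    [psi (phi i)] instead of an equality avoids casts between pastures at equal indices. *)
Lemma colimit_transfer (D D' : diagram) (L L' : pasture)
    (c : cocone D L) (c' : cocone D' L') (t : pmorph L L') (t' : pmorph L' L)
    (psi : dindex D -> dindex D') (kappa : forall d, pmorph (D d) (D' (psi d)))
    (phi : dindex D' -> dindex D) (iota : forall i, pmorph (D' i) (D (phi i))) :
  cancel t t' -> cancel t' t ->
  (forall d x, c' (psi d) (kappa d x) = t (c d x)) ->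
  (forall d e (h : dhom d e), exists h' : dhom (psi d) (psi e),
     forall x, dmap h' (kappa d x) = kappa e (dmap h x)) ->
  (forall i, exists h : dhom i (psi (phi i)),
     forall x, dmap h x = kappa (phi i) (iota i x)) ->
  is_colimit c -> is_colimit c'.
Proof.
move=> tK t'K ct knat back cl P k.
pose k0 d := pmorph_comp (k (psi d)) (kappa d).
have k0P d e (h : dhom d e) x : k0 e (dmap h x) = k0 d x.
  by have [h' hE] := knat _ _ h; rewrite /= -hE cinjP.
have [f [fE fU]] := cl _ (Cocone k0P).
exists (pmorph_comp f t'); split=> [i x|u uE] /=.
  have [h hE] := back i.
  by rewrite -(cinjP c' h) hE ct tK fE /= -hE cinjP.
have <- : pmorph_comp u t = f by apply: fU => d x /=; rewrite -ct uE.
by apply: pmorph_eq => y /=; rewrite t'K.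
Qed.

(** * Equality of matroids, and isomorphisms given by partial maps *)

Lemma matroid_eq (T : finType) (M N : matroid T) :
  ground M = ground N -> bases M = bases N -> M = N.
Proof.
case: M N => gM bM p1 p2 p3 [gN bN q1 q2 q3] /= eg eb; subst gN bN.
by congr Matroid; apply: Prop_irrelevance.
Qed.

Section PartialImage.
Variables (T T' : finType) (f : T -> option T').
Implicit Types A B : {set T}.

Definition pim A : {set T'} := [set y in pmap f (enum A)].

Lemma pimP A y : reflect (exists2 x, x \in A & f x = Some y) (y \in pim A).
Proof.
rewrite inE mem_pmap; apply: (iffP mapP) => -[x xA E]; exists x => //.
  by rewrite mem_enum in xA.
by rewrite mem_enum.
Qed.

Lemma pimS A B : A \subset B -> pim A \subset pim B.
Proof.
move=> /subsetP AB; apply/subsetP => y /pimP[x /AB xB E].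
by apply/pimP; exists x.
Qed.

Lemma pimU A B : pim (A :|: B) = pim A :|: pim B.
Proof.
apply/setP => y; rewrite in_setU; apply/pimP/orP => [[x]|].
  by rewrite inE => /orP[xA|xB] E; [left|right]; apply/pimP; exists x.
by case=> /pimP[x xA E]; exists x; rewrite // inE xA ?orbT.
Qed.

Lemma pim_seq (s : seq T) : pim [set x in s] = [set y in pmap f s].
Proof.
apply/setP => y; rewrite [RHS]inE mem_pmap; apply/pimP/mapP => -[x xs E];
  by exists x; rewrite // inE in xs *.
Qed.

Lemma pmap_uniq_in (s : seq T) : {in s &, injective f} -> all f s ->
  uniq (pmap f s) = uniq s.
Proof.
move=> fI /all_filterP fs; rewrite -(map_inj_uniq (@Some_inj _)).
by rewrite pmapS_filter fs map_inj_in_uniq.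
Qed.

End PartialImage.

Lemma pmap_Some (T : Type) (s : seq T) : pmap some s = s.
Proof. by elim: s => //= x s ->. Qed.

Lemma pim_Some (T : finType) (A : {set T}) : pim some A = A.
Proof. by apply/setP => y; rewrite inE pmap_Some mem_enum. Qed.

(** Partial functions are used because a function [T -> T'] extending a given
bijection of ground sets need not exist when [T'] is empty. *)
Record bij_via (T T' : finType) (E : {set T}) (E' : {set T'})
    (f : T -> option T') (g : T' -> option T) : Prop := BijVia {
  bij_viaL : forall x, x \in E -> exists2 y, y \in E' & f x = Some y /\ g y = Some x;
  bij_viaR : forall y, y \in E' -> exists2 x, x \in E & g y = Some x /\ f x = Some y }.

Lemma bij_via_sym (T T' : finType) (E : {set T}) (E' : {set T'}) f g :
  bij_via E E' f g -> bij_via E' E g f.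
Proof. by case. Qed.

Section BijVia.
Variables (T T' : finType) (E : {set T}) (E' : {set T'}).
Variables (f : T -> option T') (g : T' -> option T).
Hypothesis fg : bij_via E E' f g.
Implicit Types A B : {set T}.

Lemma bij_via_inj : {in E &, injective f}.
Proof.
move=> x y /(bij_viaL fg)[x' _ [fx gx]] /(bij_viaL fg)[y' _ [fy gy]].
by rewrite fx fy => -[xy]; move: gx; rewrite xy gy => -[].
Qed.

Lemma pimK A : A \subset E -> pim g (pim f A) = A.
Proof.
move=> /subsetP AE; apply/setP => x; apply/pimP/idP => [[y /pimP[z zA fz] gy]|xA].
  have [y' _ [fz' gz]] := bij_viaL fg (AE _ zA).
  by move: fz gy; rewrite fz' => -[<-]; rewrite gz => -[<-].
have [y _ [fx gy]] := bij_viaL fg (AE _ xA).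
by exists y => //; apply/pimP; exists x.
Qed.

Lemma pim_sub A : A \subset E -> pim f A \subset E'.
Proof.
move=> /subsetP AE; apply/subsetP => y /pimP[x /AE /(bij_viaL fg)].
by case=> z zE [-> _] [<-].
Qed.

Lemma mem_pim A x y : A \subset E -> x \in E -> f x = Some y ->
  (y \in pim f A) = (x \in A).
Proof.
move=> /subsetP AE xE fx; apply/pimP/idP => [[z zA fz]|xA]; last by exists x.
by rewrite (bij_via_inj xE (AE _ zA)) // fx fz.
Qed.

Lemma pimD A B : A \subset E -> B \subset E ->
  pim f (A :\: B) = pim f A :\: pim f B.
Proof.
move=> AE BE; apply/setP => y; rewrite in_setD.
apply/pimP/andP => [[x /setDP[xA xB] fx]|[yB /pimP[x xA fx]]].
  have xE := subsetP AE _ xA.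
  by rewrite (mem_pim BE xE fx) xB (mem_pim AE xE fx).
exists x => //; rewrite inE xA andbT.
by rewrite -(mem_pim BE _ fx) // (subsetP AE).
Qed.

Lemma pim_disjoint A B : A \subset E -> B \subset E ->
  [disjoint A & B] -> [disjoint pim f A & pim f B].
Proof.
move=> AE BE dAB; rewrite disjoint_subset; apply/subsetP => y /pimP[x xA fx].
by rewrite inE (mem_pim BE _ fx) ?(disjointFr dAB) // (subsetP AE).
Qed.

(** The left side follows the enumeration of [T], the right side that of [T'], so only a permutation
    relates them. *)
Lemma perm_pim A : A \subset E -> perm_eq (pmap f (enum A)) (enum (pim f A)).
Proof.
move=> /subsetP AE; apply: uniq_perm; rewrite ?enum_uniq //.
  rewrite pmap_uniq_in ?enum_uniq //.
    by move=> x y; rewrite !mem_enum => /AE xE /AE yE; apply: bij_via_inj.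
  apply/allP => x; rewrite mem_enum => /AE /(bij_viaL fg)[y _ [fx _]].
  by rewrite /= fx.
by move=> y; rewrite mem_enum inE.
Qed.

Lemma pim_full : pim f E = E'.
Proof.
apply/eqP; rewrite eqEsubset pim_sub //; apply/subsetP => y yE'.
by have [x xE [_ fx]] := bij_viaR fg yE'; apply/pimP; exists x.
Qed.

Lemma bij_via_pim A : A \subset E -> bij_via A (pim f A) f g.
Proof.
move=> /subsetP AE; split=> [x xA|y /pimP[x xA fx]].
  have [y _ [fx gy]] := bij_viaL fg (AE _ xA).
  by exists y => //; apply/pimP; exists x.
have [y' _ [fx' gy]] := bij_viaL fg (AE _ xA).
by move: fx' gy; rewrite fx => -[<-] gy; exists x.
Qed.

End BijVia.

(** Unlike the bijection of subtypes in [miso], the pair [f], [g] serves unchanged for all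
    corresponding minors of [M] and [M']. *)
Definition iso_via (T T' : finType) (M : matroid T) (M' : matroid T')
    (f : T -> option T') (g : T' -> option T) : Prop :=
  bij_via (ground M) (ground M') f g /\
  forall B : {set T}, B \subset ground M -> (B \in bases M) = (pim f B \in bases M').

Lemma iso_via_sym (T T' : finType) (M : matroid T) (M' : matroid T') f g :
  iso_via M M' f g -> iso_via M' M g f.
Proof.
move=> [fg fB]; have gf := bij_via_sym fg; split=> // B BM'.
by rewrite fB ?(pim_sub gf) // (pimK gf).
Qed.

Lemma iso_via_id (T : finType) (M : matroid T) : iso_via M M some some.
Proof.
split=> [|B _]; last by rewrite pim_Some.
by split=> x xM; exists x.
Qed.

Lemma miso_via (T T' : finType) (M : matroid T) (M' : matroid T') :
  miso M M' -> exists f g, iso_via M M' f g.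
Proof.
move=> [h [[h' hK h'K] hB]].
exists (fun x => omap (fun u => val (h u)) (insub x)).
exists (fun y => omap (fun v => val (h' v)) (insub y)).
set f := fun x => _; set g := fun y => _.
have fE u : f (val u) = Some (val (h u)) by rewrite /f valK.
have gE v : g (val v) = Some (val (h' v)) by rewrite /g valK.
split=> [|B BM].
  split=> [x xM|y yM].
    pose u : {x | x \in ground M} := exist _ x xM.
    by exists (val (h u)); rewrite ?(valP (h u)) // -[x]/(val u) fE gE hK.
  pose v : {y | y \in ground M'} := exist _ y yM.
  by exists (val (h' v)); rewrite ?(valP (h' v)) // -[y]/(val v) fE gE h'K.
pose A := [set u : {x | x \in ground M} | val u \in B].
have <- : val @: A = B.
  apply/setP => x; apply/imsetP/idP => [[u + ->]|xB]; first by rewrite inE.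
  have xM := subsetP BM _ xB.
  by exists (exist _ x xM); rewrite ?inE.
suff -> : pim f (val @: A) = val @: (h @: A) by apply: hB.
apply/setP => y; apply/pimP/imsetP => [[_ /imsetP[u uA ->]]|[_ /imsetP[u uA ->] ->]].
  by rewrite fE => -[<-]; exists (h u); rewrite ?imset_f.
by exists (val u); rewrite ?imset_f ?fE.
Qed.

Lemma via_miso (T T' : finType) (M : matroid T) (M' : matroid T') f g :
  iso_via M M' f g -> miso M M'.
Proof.
move=> [fg fB].
have /choice[h hP] (u : {x | x \in ground M}) : exists v : {y | y \in ground M'},
    f (val u) = Some (val v) /\ g (val v) = Some (val u).
  have [y yM fgy] := bij_viaL fg (valP u).
  by exists (exist _ y yM).
have /choice[h' h'P] (v : {y | y \in ground M'}) : exists u : {x | x \in ground M},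
    g (val v) = Some (val u) /\ f (val u) = Some (val v).
  have [x xM gfx] := bij_viaR fg (valP v).
  by exists (exist _ x xM).
have hE u : f (val u) = Some (val (h u)) by case: (hP u).
exists h; split=> [|A].
  exists h' => [u|v]; apply: val_inj.
    by have := (hP u).2; rewrite (h'P _).1 => -[].
  by have := (h'P v).2; rewrite (hP _).1 => -[].
rewrite fB; last by apply/subsetP => _ /imsetP[u _ ->]; apply: valP.
suff -> : pim f (val @: A) = val @: (h @: A) by [].
apply/setP => y; apply/pimP/imsetP => [[_ /imsetP[u uA ->]]|[_ /imsetP[u uA ->] ->]].
  by rewrite hE => -[<-]; exists (h u); rewrite ?imset_f.
by exists (val u); rewrite ?imset_f ?hE.
Qed.


(** * Induced morphisms of foundations *)

(** [restr N I] is the case [f = some], [l = enum I]. With an arbitrary sequence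
[l], composing relabellings is strictly associative, no sign being introduced
by a reordering. *)
Definition relabel (T T' : finType) (P : pasture) (N : matroid T)
    (f : T -> option T') (l : seq T') (D : seq T' -> P) (s : seq T) : P :=
  if all (mem (ground N)) s then D (pmap f s ++ l) else 0.

Lemma relabel_rescaling (T T' : finType) (P : pasture) (N : matroid T)
    (f : T -> option T') (l : seq T') (D D' : seq T' -> P) :
  rescaling D D' -> rescaling (relabel N f l D) (relabel N f l D').
Proof.
move=> [c [d [nc nd E]]].
(* [pmap f] drops the elements where [f] is undefined, so their weight must be 1. The product over
   the fixed tail [l] goes into the scalar. *)
pose d' x := if f x is Some y then d y else 1.
exists (c * \big[@pmul P/1]_(y <- l) d y), d'; split=> [|x|s].
- by apply: pmul_neq0 => //; apply: pprod_neq0.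
- by rewrite /d'; case: (f x) => [y|] //; apply: pone_neq0.
rewrite /relabel; case: ifP => _; last by rewrite pmul0r.
rewrite E big_cat /= -!pmulA; congr (_ * _); rewrite pmulCA; congr (_ * (_ * _)).
elim: s => [|x s IHs] /=; first by rewrite !big_nil.
rewrite big_cons /d' -IHs; case: (f x) => [y|] /=; last by rewrite pmul1.
by rewrite big_cons.
Qed.

Lemma relabel_morph (T T' : finType) (P Q : pasture) (u : pmorph P Q)
    (N : matroid T) (f : T -> option T') (l : seq T') (D : seq T' -> P) :
  u \o relabel N f l D = relabel N f l (u \o D).
Proof.
by apply/funext => s /=; rewrite /relabel; case: ifP => _; rewrite ?pfun0.
Qed.

Lemma relabel_comp (T T' T'' : finType) (P : pasture) (N : matroid T)
    (K : matroid T') (f : T -> option T') (f' : T' -> option T'')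
    (l : seq T') (l' : seq T'') (D : seq T'' -> P) :
  (forall x, x \in ground N -> exists2 y, y \in ground K & f x = Some y) ->
  {subset l <= ground K} ->
  relabel N f l (relabel K f' l' D) =
  relabel N (fun x => obind f' (f x)) (pmap f' l ++ l') D.
Proof.
move=> NK lK; apply/funext => s; rewrite /relabel.
case: (boolP (all (mem (ground N)) s)) => // /allP sN.
have -> : all (mem (ground K)) (pmap f s ++ l).
  apply/allP => y; rewrite mem_cat => /orP[|/lK//].
  rewrite mem_pmap => /mapP[x /sN /NK[z zK ->] [->]]; exact: zK.
rewrite pmap_cat -catA; congr (D (_ ++ _)).
by elim: s {sN} => //= x s IHs; case: (f x) => [y|] //=; rewrite IHs.
Qed.

(** By alternation, reordering the tail multiplies all values by one common unit, which a rescaling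
    absorbs. *)
Lemma relabel_perm (T T' : finType) (P : pasture) (N : matroid T)
    (M : matroid T') (f : T -> option T') (l l' : seq T') (D : seq T' -> P) :
  is_repr M D -> perm_eq l l' -> rescaling (relabel N f l D) (relabel N f l' D).
Proof.
move=> rD; rewrite perm_sym => /(repr_perm rD)[e ne eE].
exists e, (fun=> 1); split=> // [x|s]; first exact: pone_neq0.
rewrite big1 // pmul1r /relabel; case: ifP => _; first exact: eE.
by rewrite pmul0r.
Qed.

Lemma eq_relabel (T T' : finType) (P : pasture) (N : matroid T)
    (f f' : T -> option T') (l : seq T') (D : seq T' -> P) :
  {in ground N, f =1 f'} -> relabel N f l D = relabel N f' l D.
Proof.
move=> ff'; apply/funext => s; rewrite /relabel; case: ifP => // /allP sN.
congr (D (_ ++ _)); elim: s sN => //= x s IHs sN.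
have -> : f x = f' x by apply/ff'/sN; rewrite mem_head.
by rewrite IHs // => y ys; apply: sN; rewrite inE ys orbT.
Qed.

(** Describes a morphism of foundations by combinatorial data. [induced_comp] composes the data and
    [induced_uniq] shows that they determine the morphism, so an identity between composites reduces
    to comparing maps on the ground set and lists up to order. *)
Definition induced (T T' : finType) (N : matroid T) (M : matroid T')
    (f : T -> option T') (l : seq T') (u : pmorph (foundation N) (foundation M)) :=
  rescaling (u \o @univ_repr T N) (relabel N f l (@univ_repr T' M)).

Lemma induced_comp (T T' T'' : finType) (N : matroid T) (K : matroid T')
    (M : matroid T'') f (l : seq T') f' l' (u : pmorph (foundation N) (foundation K))
    (u' : pmorph (foundation K) (foundation M)) :
  (forall x, x \in ground N -> exists2 y, y \in ground K & f x = Some y) ->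
  {subset l <= ground K} -> induced f l u -> induced f' l' u' ->
  induced (fun x => obind f' (f x)) (pmap f' l ++ l') (pmorph_comp u' u).
Proof.
move=> NK lK iu iu'; have := rescaling_morph u' iu.
rewrite relabel_morph => /rescaling_trans; apply.
by rewrite -(relabel_comp _ _ _ NK lK); apply: relabel_rescaling.
Qed.

Lemma induced_uniq (T T' : finType) (N : matroid T) (M : matroid T')
    f f' l l' (u u' : pmorph (foundation N) (foundation M)) :
  {in ground N, f =1 f'} -> perm_eq l l' ->
  induced f l u -> induced f' l' u' -> u = u'.
Proof.
move=> ff' ll' iu; rewrite /induced -(eq_relabel _ _ ff') => iu'.
have {}iu : rescaling (u \o @univ_repr T N) (relabel N f l' (@univ_repr T' M)).
  by apply: rescaling_trans iu _; apply: relabel_perm ll'; apply: (foundationP M).1.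
(* The relabelled function is a representation of [N] because it is a rescaling of the image of the
   universal one under [u]; the universal property of [foundation N] then applies to it. *)
have rD := repr_rescaling (repr_morph u (foundationP N).1) iu.
have [v [_ vU]] := (foundationP N).2 _ _ rD.
exact: etrans (vU _ iu) (esym (vU _ iu')).
Qed.

Lemma induced_fnd_map (T : finType) (N M : matroid T) (I : {set T})
  (h : minor_emb N M I) : induced some (enum I) (fnd_map h).
Proof.
apply: rescaling_trans (fnd_mapP h) _; apply: rescaling_eq => s.
by rewrite /restr /relabel pmap_Some.
Qed.

Lemma induced_id (T : finType) (N : matroid T) :
  induced some [::] (pmorph_id (foundation N)).
Proof.
apply: rescaling_eq => s /=; rewrite /relabel pmap_Some cats0.
(* Off the ground set [relabel] is zero by definition, and the universal representation is zero
   there because its support consists of ordered bases. *)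
case: ifPn => // /negP sN; case: (pselect (univ_repr N s = 0)) => // nz.
case: sN; have /andP[_ /bases_ground /subsetP sN] :=
  (repr_supp (foundationP N).1 s).1 nz.
by apply/allP => x xs; apply: sN; rewrite inE.
Qed.

Section IsoInduced.
Variables (T T' : finType) (M : matroid T) (M' : matroid T').
Variables (f : T -> option T') (g : T' -> option T).
Hypothesis fg : iso_via M M' f g.

Lemma relabel_repr (P : pasture) (D : seq T' -> P) :
  is_repr M' D -> is_repr M (relabel M f [::] D).
Proof.
have [bfg fB] := fg => -[Ds Da Dp].
have fM x : x \in ground M -> exists y, f x = Some y.
  by case/(bij_viaL bfg) => y _ []; exists y.
split=> [s|s1 s2 s3 x y|a b c d s].
- rewrite /relabel cats0; case: ifPn => [/allP sM|nsM]; last first.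
    split=> // /andP[_ /bases_ground /subsetP sM]; case/negP: nsM.
    by apply/allP => x xs; apply: sM; rewrite inE.
  rewrite Ds /ordered_basis fB; last by apply/subsetP => x; rewrite inE => /sM.
  rewrite pim_seq pmap_uniq_in //.
    by move=> x y /sM xM /sM yM; apply: (bij_via_inj bfg).
  by apply/allP => x /sM /fM[y ->].
- rewrite /relabel (perm_all _ (perm_swap s1 s2 s3 x y)).
  case: ifPn; rewrite ?popp0 // !cats0 all_cat /= all_cat /=.
  case/and4P=> _ /fM[y' fy] _ /andP[/fM[x' fx] _].
  by rewrite !pmap_cat /= !pmap_cat /= fx fy /= Da.
- rewrite /relabel /=; set q := all _ s.
  (* Each of the three Plücker products involves all of [a], [b], [c], [d] and [s], so a single
     entry off the ground set makes all three vanish. *)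
  have [aM|] := boolP (a \in ground M); have [bM|] := boolP (b \in ground M);
  have [cM|] := boolP (c \in ground M); have [dM|] := boolP (d \in ground M);
    case: q => /=; rewrite ?pmul0 ?pmul0r ?popp0; try by move=> *; exact: pnull000.
  have [a' ->] := fM _ aM; have [b' ->] := fM _ bM.
  have [c' ->] := fM _ cM; have [d' ->] := fM _ dM.
  by rewrite /= !cats0.
Qed.

Definition fnd_iso : pmorph (foundation M) (foundation M') :=
  sval (cid ((foundationP M).2 _ _ (relabel_repr (foundationP M').1))).

Lemma induced_iso : induced f [::] fnd_iso.
Proof. by rewrite /fnd_iso; case: cid => u []. Qed.

End IsoInduced.

Lemma fnd_isoK (T T' : finType) (M : matroid T) (M' : matroid T') f g
  (fg : iso_via M M' f g) (gf : iso_via M' M g f) :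
  cancel (fnd_iso fg) (fnd_iso gf).
Proof.
have ic := induced_comp _ _ (induced_iso fg) (induced_iso gf).
suff E : pmorph_comp (fnd_iso gf) (fnd_iso fg) = pmorph_id _.
  by move=> x; rewrite -[RHS]/(pmorph_id _ x) -E.
apply: induced_uniq (ic _ _) (induced_id M) => //.
- by move=> y /(bij_viaL fg.1)[z zM [-> gy]].
- by move=> y /(bij_viaL fg.1)[z zM [fy _]]; exists z.
Qed.

(** * Embedded minors *)

Lemma minor_emb_ctr (T : finType) (N M : matroid T) (I : {set T}) :
  minor_emb N M I -> I \subset ground M.
Proof.
move=> [_ _ NE]; have [B bB] := bases_neq0 N.
have := bB; rewrite NE ?(bases_ground bB) // => /bases_ground.
by rewrite subUset => /andP[].
Qed.

(** Independence of [mctr p] and coindependence of [mdel p] come with two possibly different bases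
    of [M]. A basis of the minor, enlarged by [mctr p], witnesses both at once. *)
Lemma emb_minor_basis (T : finType) (M : matroid T) (p : emb_minor M) :
  exists2 B, B \in bases M & (mctr p \subset B) && [disjoint mdel p & B].
Proof.
have [B bB] := bases_neq0 (minor p).
have Bg := bases_ground bB; move: bB; rewrite inE => /andP[_ bB].
exists (B :|: mctr p) => //; rewrite subsetUr /= disjoint_sym disjoint_subset.
apply/subsetP => x; rewrite !inE => /orP[/(subsetP Bg)|xI].
  by rewrite !inE negb_or => /andP[/andP[]].
by rewrite (disjointFr (mctr_del p) xI).
Qed.

Lemma mctr_ground (T : finType) (M : matroid T) (p : emb_minor M) :
  mctr p \subset ground M.
Proof. exact: minor_emb_ctr (minor_emb_top p). Qed.

Lemma mdel_ground (T : finType) (M : matroid T) (p : emb_minor M) :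
  mdel p \subset ground M.
Proof. by have /andP[] := mdel_coindep p. Qed.

Lemma emb_minor_build (T : finType) (M : matroid T) (I J : {set T}) :
  [disjoint I & J] -> J \subset ground M ->
  (exists2 B, B \in bases M & (I \subset B) && [disjoint J & B]) ->
  exists2 p : emb_minor M, mctr p = I & mdel p = J.
Proof.
move=> IJ JM [B bB /andP[IB JB]].
have iI : mindep M I by apply/exists_inP; exists B.
have cJ : mcoindep M J by rewrite /mcoindep JM; apply/exists_inP; exists B.
by exists (EmbMinor IJ iI cJ).
Qed.

Lemma emb_le_refl (T : finType) (M : matroid T) (p : emb_minor M) : emb_le p p.
Proof. by []. Qed.

Lemma emb_le_trans (T : finType) (M : matroid T) (p q r : emb_minor M) :
  emb_le p q -> emb_le q r -> emb_le p r.
Proof.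
by move=> [? ?] [? ?]; split; [apply: subset_trans|apply: subset_trans];
  eassumption.
Qed.

(** * Functoriality of foundations on minors, and colimits in two steps *)

Lemma fnd_map_refl (T : finType) (M : matroid T) (p : emb_minor M)
  (h : emb_le p p) x : fnd_map (minor_emb_le h) x = x.
Proof.
suff -> : fnd_map (minor_emb_le h) = pmorph_id _ by [].
apply: induced_uniq (induced_fnd_map _) (induced_id _) => //.
by rewrite setDv enum_set0.
Qed.

Lemma enum_setD_perm (T : finType) (A B C : {set T}) :
  C \subset B -> B \subset A ->
  perm_eq (enum (A :\: B) ++ enum (B :\: C)) (enum (A :\: C)).
Proof.
move=> /subsetP CB /subsetP BA; apply: uniq_perm; rewrite ?enum_uniq //.
  rewrite cat_uniq !enum_uniq andbT /=; apply/hasP => -[x].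
  by rewrite /= !mem_enum !inE => /andP[_ ->].
move=> x; rewrite mem_cat !mem_enum !inE.
have := CB x; have := BA x.
by case: (x \in A) (x \in B) (x \in C) => [] [] [] // b c;
  do ?[by have := b isT | by have := c isT].
Qed.

(** Contracting in two stages appends two lists, which together enumerate the total contracted set
    up to order. *)
Lemma fnd_map_le_comp (T : finType) (M : matroid T) (p q r : emb_minor M)
    (pq : emb_le p q) (qr : emb_le q r) (pr : emb_le p r) x :
  fnd_map (minor_emb_le qr) (fnd_map (minor_emb_le pq) x)
    = fnd_map (minor_emb_le pr) x.
Proof.
set u := fnd_map _; set v := fnd_map _.
rewrite -[LHS]/(pmorph_comp u v x).
suff -> : pmorph_comp u v = fnd_map (minor_emb_le pr) by [].
have ic := induced_comp _ _ (induced_fnd_map (minor_emb_le pq))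
  (induced_fnd_map (minor_emb_le qr)).
apply: induced_uniq (ic _ _) (induced_fnd_map _) => //.
- by rewrite pmap_Some enum_setD_perm // ?pq.1 ?qr.1.
- by move=> y yp; exists y => //; case: (minor_emb_le pq) => /subsetP/(_ _ yp).
- by move=> y; rewrite mem_enum; apply/subsetP/emb_le_ctr.
Qed.

(** Minors of [minor p] are indexed by the embedded minors of [M] below [p], which makes them a
    subdiagram of the minors of [M]. [colimit_minor] relates this indexing to the intrinsic one. *)
Definition local_cocone (T : finType) (M : matroid T) (p : emb_minor M)
    (Q : emb_minor M -> Prop) :
    cocone (fnd_diagram (fun q => emb_le q p /\ Q q)) (foundation (minor p)) :=
  @Cocone (fnd_diagram (fun q => emb_le q p /\ Q q)) (foundation (minor p))
    (fun q => fnd_map (minor_emb_le (proj1 (proj2_sig q))))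
    (fun q r h x => fnd_map_le_comp h _ _ x).

(** A cocone over [Q] extends uniquely to [Q']: its component at [p] must be the morphism mediated
    by the local colimit at [p]. Hence the two universal properties of [foundation M] coincide. *)
Lemma colimit_local (T : finType) (M : matroid T) (Q Q' : emb_minor M -> Prop) :
  (forall p, Q p -> Q' p) ->
  (forall p, Q' p -> is_colimit (local_cocone p Q)) ->
  is_colimit (fnd_cocone Q) <-> is_colimit (fnd_cocone Q').
Proof.
move=> QQ' loc; split=> cl P k.
- have kP (p q : {p | Q p}) (h : emb_le (sval p) (sval q)) x :
      k (exist _ (sval q) (QQ' _ (proj2_sig q))) (fnd_map (minor_emb_le h) x)
      = k (exist _ (sval p) (QQ' _ (proj2_sig p))) x.
    exact: (cinjP k (i := exist _ (sval p) (QQ' _ (proj2_sig p)))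
                    (j := exist _ (sval q) (QQ' _ (proj2_sig q))) h x).
  pose k0 : cocone (fnd_diagram Q) P :=
    @Cocone (fnd_diagram Q) P (fun p => k (exist _ _ (QQ' _ (proj2_sig p)))) kP.
  have [u [uE uU]] := cl _ k0.
  exists u; split=> [[p Q'p] x|v vE]; last first.
    by apply: uU => -[q Qq] x; apply: (vE (exist _ q (QQ' _ Qq)) x).
  (* At an index [p] of [Q'], the restriction of [u] and the component of [k] both mediate the
     cocone [j], so uniqueness for the local colimit identifies them. *)
  pose j : cocone (fnd_diagram (fun q => emb_le q p /\ Q q)) P :=
    @Cocone (fnd_diagram (fun q => emb_le q p /\ Q q)) P
      (fun q => k0 (exist _ (sval q) (proj2_sig q).2))
      (fun q r h x => cinjP k0 (i := exist _ (sval q) (proj2_sig q).2)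
         (j := exist _ (sval r) (proj2_sig r).2) h x).
  have [w [_ wU]] := loc _ Q'p _ j.
  rewrite -[LHS]/(pmorph_comp u (fnd_map (minor_emb_top p)) x).
  suff -> : pmorph_comp u (fnd_map (minor_emb_top p)) = k (exist _ p Q'p) by [].
  apply: etrans (wU _ _) (esym (wU _ _)) => q y.
    by rewrite /= fnd_map_comp; apply: (uE (exist _ (sval q) (proj2_sig q).2) y).
  exact: (cinjP k (i := exist _ (sval q) (QQ' _ (proj2_sig q).2))
                  (j := exist _ p Q'p) (proj2_sig q).1 y).
- pose j p : cocone (fnd_diagram (fun q => emb_le q p /\ Q q)) P :=
    @Cocone (fnd_diagram (fun q => emb_le q p /\ Q q)) P
      (fun q => k (exist _ (sval q) (proj2_sig q).2))
      (fun q r h x => cinjP k (i := exist _ (sval q) (proj2_sig q).2)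
         (j := exist _ (sval r) (proj2_sig r).2) h x).
  (* [w p] is the component at [p] of the extension of [k] to [Q']. *)
  pose w (p : {p | Q' p}) := sval (cid (loc _ (proj2_sig p) P (j (sval p)))).
  have wP p : (forall i x, w p (local_cocone (sval p) Q i x) = j (sval p) i x) /\
      forall v : pmorph _ P,
        (forall i x, v (local_cocone (sval p) Q i x) = j (sval p) i x) -> v = w p
    := svalP (cid (loc _ (proj2_sig p) P (j (sval p)))).
  have wE (p : {p | Q' p}) (q : emb_minor M) (h : emb_le q (sval p)) (Qq : Q q) x :
      w p (fnd_map (minor_emb_le h) x) = k (exist _ q Qq) x.
    (* [proj1] and [proj2] are opaque *)
    have := (wP p).1 (exist _ q (conj h Qq)) x => /=.
    by rewrite (Prop_irrelevance (proj1 _) h) (Prop_irrelevance (proj2 _) Qq).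
  have wcomp (p q : {p | Q' p}) (h : emb_le (sval p) (sval q)) x :
      w q (fnd_map (minor_emb_le h) x) = w p x.
    rewrite -[LHS]/(pmorph_comp (w q) (fnd_map (minor_emb_le h)) x).
    suff -> : pmorph_comp (w q) (fnd_map (minor_emb_le h)) = w p by [].
    apply: (wP p).2 => r y /=.
    rewrite (fnd_map_le_comp _ _ (emb_le_trans (proj2_sig r).1 h)).
    exact: (wE q (sval r) _ (proj2_sig r).2 y).
  have [u [uE uU]] := cl _ (@Cocone (fnd_diagram Q') P w wcomp).
  exists u; split=> [[q Qq] x|v vE].
    (* [q] belongs to its own local diagram, through the identity embedding. *)
    rewrite -(wE (exist _ q (QQ' _ Qq)) q (emb_le_refl q)) fnd_map_refl.
    exact: (uE (exist _ q (QQ' _ Qq)) x).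
  apply: uU => -[p Q'p] x.
  rewrite -[LHS]/(pmorph_comp v (fnd_map (minor_emb_top p)) x).
  suff -> : pmorph_comp v (fnd_map (minor_emb_top p)) = w (exist _ p Q'p) by [].
  apply: (wP (exist _ p Q'p)).2 => q y /=.
  by rewrite fnd_map_comp; apply: (vE (exist _ (sval q) (proj2_sig q).2)).
Qed.

(** The improper minor is a terminal index, and a diagram with a terminal index has its value there
    as colimit. *)
Lemma colimit_terminal (T : finType) (M : matroid T) (Q : emb_minor M -> Prop)
    (p : emb_minor M) :
  Q p -> minor p = M -> mctr p = set0 -> mdel p = set0 -> is_colimit (fnd_cocone Q).
Proof.
move=> Qp pM pI pJ P k.
(* The equality [minor p = M] enters only through [iso_via], so no cast between the two foundations
   appears. *)
have viaM : iso_via M (minor p) some some by rewrite pM; apply: iso_via_id.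
have viap : iso_via (minor p) M some some by rewrite pM; apply: iso_via_id.
have topE : fnd_map (minor_emb_top p) = fnd_iso viap.
  apply: induced_uniq (induced_fnd_map _) (induced_iso _) => //.
  by rewrite pI enum_set0.
exists (pmorph_comp (k (exist _ p Qp)) (fnd_iso viaM)); split=> [[q Qq] x|v vE].
  have qp : emb_le q p by split; rewrite ?pI ?pJ sub0set.
  rewrite /= -(fnd_map_comp qp) topE fnd_isoK.
  exact: (cinjP k (i := exist _ q Qq) (j := exist _ p Qp) qp x).
by apply: pmorph_eq => x /=; rewrite -(vE (exist _ p Qp)) /= topE fnd_isoK.
Qed.

(** * Transport of diagrams of minors *)

(** Both composites are induced by [f] together with a list enumerating [I'], in possibly different
    orders. *)
Lemma fnd_iso_map (T T' : finType) (N K : matroid T) (N' K' : matroid T') f g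
    (I : {set T}) (I' : {set T'}) (fgN : iso_via N N' f g) (fgK : iso_via K K' f g)
    (h : minor_emb N K I) (h' : minor_emb N' K' I') :
  pim f I = I' ->
  forall x, fnd_map h' (fnd_iso fgN x) = fnd_iso fgK (fnd_map h x).
Proof.
move=> fI x; rewrite -[LHS]/(pmorph_comp (fnd_map h') (fnd_iso fgN) x).
suff -> : pmorph_comp (fnd_map h') (fnd_iso fgN)
  = pmorph_comp (fnd_iso fgK) (fnd_map h) by [].
have ic := induced_comp _ _ (induced_iso fgN) (induced_fnd_map h').
have ic' := induced_comp _ _ (induced_fnd_map h) (induced_iso fgK).
apply: induced_uniq (ic _ _) (ic' _ _) => //.
- by move=> y _ /=; case: (f y).
- by rewrite /= cats0 -fI perm_sym; apply: (perm_pim fgK.1); apply: minor_emb_ctr h.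
- by move=> y /(bij_viaL fgN.1)[z zN [fy _]]; exists z.
- by move=> y yN; exists y => //; have [/subsetP/(_ _ yN)] := h.
- by move=> y; rewrite mem_enum; apply/subsetP/(minor_emb_ctr h).
Qed.

(** The targets [K], [K'] and the contracted sets [l], [l'] are left free to cover two cases: minors
    of [minor p] seen inside [M], with [f] and [g] the identity, and minors of isomorphic
    matroids. *)
Lemma minors_transfer (T T' : finType) (M K : matroid T) (M' K' : matroid T')
    (Q : emb_minor M -> Prop) (Q' : emb_minor M' -> Prop)
    (c : cocone (fnd_diagram Q) (foundation K))
    (c' : cocone (fnd_diagram Q') (foundation K'))
    (l : {p | Q p} -> {set T}) (l' : {p | Q' p} -> {set T'})
    (h : forall p, minor_emb (minor (sval p)) K (l p))
    (h' : forall p, minor_emb (minor (sval p)) K' (l' p)) f g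
    (psi : {p | Q p} -> {p | Q' p}) (phi : {p | Q' p} -> {p | Q p}) :
  (forall p, c p = fnd_map (h p)) -> (forall p, c' p = fnd_map (h' p)) ->
  iso_via K K' f g ->
  (forall p, iso_via (minor (sval p)) (minor (sval (psi p))) f g) ->
  (forall p, iso_via (minor (sval p)) (minor (sval (phi p))) g f) ->
  (forall p, pim f (l p) = l' (psi p)) ->
  (forall p q, emb_le (sval p) (sval q) ->
     emb_le (sval (psi p)) (sval (psi q)) /\
     pim f (mctr (sval p) :\: mctr (sval q))
       = mctr (sval (psi p)) :\: mctr (sval (psi q))) ->
  (forall p, mctr (sval (psi (phi p))) = mctr (sval p) /\
             mdel (sval (psi (phi p))) = mdel (sval p)) ->
  is_colimit c -> is_colimit c'.
Proof.
move=> cE c'E fg ipsi iphi fl fle back.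
have gf := iso_via_sym fg.
apply: (@colimit_transfer _ _ _ _ c c' (fnd_iso fg) (fnd_iso gf) psi
  (fun p => fnd_iso (ipsi p)) phi (fun p => fnd_iso (iphi p))).
- exact: fnd_isoK.
- exact: fnd_isoK.
- by move=> p x; rewrite c'E cE; apply: fnd_iso_map.
- move=> p q pq; have [pq' E] := fle _ _ pq; exists pq' => x /=.
  exact: fnd_iso_map.
(* Equal contracted and deleted sets give an embedding of [p] into [psi (phi p)]; its map on
   foundations is the composite of the two isomorphisms. *)
- move=> p; have [Ic Jd] := back p.
  have pp : emb_le (sval p) (sval (psi (phi p))) by rewrite /emb_le Ic Jd.
  exists pp => x; rewrite -[RHS]/(pmorph_comp (fnd_iso _) (fnd_iso _) x) /=.
  suff -> : fnd_map (minor_emb_le pp)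
    = pmorph_comp (fnd_iso (ipsi (phi p))) (fnd_iso (iphi p)) by [].
  have ic := induced_comp _ _ (induced_iso (iphi p)) (induced_iso (ipsi (phi p))).
  apply: induced_uniq (induced_fnd_map _) (ic _ _) => //.
  + by move=> y /(bij_viaL (iphi p).1)[z _ [-> /= ->]].
  + by rewrite Ic setDv enum_set0.
  + by move=> y /(bij_viaL (iphi p).1)[z zM [gy _]]; exists z.
Qed.

(** * Minors of minors *)

Lemma minor_minor (T : finType) (M : matroid T) (p r : emb_minor M)
    (q : emb_minor (minor p)) :
  mctr r = mctr q :|: mctr p -> mdel r = mdel q :|: mdel p -> minor q = minor r.
Proof.
move=> rI rJ.
have gE : minor_ground q = minor_ground r.
  rewrite /minor_ground /= rI rJ; apply/setP => x; rewrite !inE.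
  by case: (x \in mctr q) (x \in mctr p) (x \in mdel q) (x \in mdel p) => [] [] [] [].
apply: matroid_eq => //; apply/setP => B; rewrite /minor /= !inE -gE rI setUA.
case: (boolP (B \subset minor_ground q)) => //= Bg.
suff -> : B :|: mctr q \subset minor_ground p by [].
by rewrite subUset (subset_trans Bg (subsetDl _ _)) mctr_ground.
Qed.

Lemma emb_minor_comp (T : finType) (M : matroid T) (p : emb_minor M)
    (q : emb_minor (minor p)) :
  exists2 r : emb_minor M, mctr r = mctr q :|: mctr p & mdel r = mdel q :|: mdel p.
Proof.
have qI := subsetP (mctr_ground q); have qJ := subsetP (mdel_ground q).
have [B bB /andP[/subsetP IB JB]] := emb_minor_basis q.
have Bg := subsetP (bases_ground bB); move: bB; rewrite inE => /andP[_ bB].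
have gP x : x \in minor_ground p ->
    [/\ x \in ground M, x \notin mctr p & x \notin mdel p].
  by rewrite !inE negb_or => /andP[/andP[-> ->] ->].
apply: emb_minor_build.
- rewrite disjoint_subset; apply/subsetP => x; rewrite !inE negb_or.
  case/orP=> [xq|xp].
    by rewrite (disjointFr (mctr_del q) xq); have [] := gP _ (qI _ xq).
  rewrite (disjointFr (mctr_del p) xp) andbT; apply/negP => /qJ /gP[_].
  by rewrite xp.
- rewrite subUset mdel_ground andbT; apply/subsetP => x /qJ /gP[] //.
(* [B] is a basis of [minor p] containing [mctr q] and avoiding [mdel q]; adding [mctr p] turns it
   into a basis of [M]. *)
exists (B :|: mctr p) => //; rewrite setSU; last exact/subsetP.
rewrite disjoint_subset; apply/subsetP => x; rewrite !inE negb_or.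
case/orP=> [xq|xp].
  by rewrite (disjointFr JB xq); have [] := gP _ (qJ _ xq).
rewrite (disjointFl (mctr_del p) xp) andbT; apply/negP => /Bg /gP[_ _].
by rewrite xp.
Qed.

Lemma emb_minor_quot (T : finType) (M : matroid T) (p q : emb_minor M) :
  emb_le q p -> exists2 r : emb_minor (minor p),
    mctr r = mctr q :\: mctr p & mdel r = mdel q :\: mdel p.
Proof.
move=> qp; have [B bB] := bases_neq0 (minor q).
have Bg := bases_ground bB; have [_ _ E] := minor_emb_le qp.
move: bB; rewrite E // => bB; apply: emb_minor_build.
- by apply: disjointWl (subsetDl _ _) _; apply: disjointWr (subsetDl _ _) _;
    apply: mctr_del.
- apply/subsetP => x; rewrite !inE negb_or => /andP[xp xq].
  rewrite xp (subsetP (mdel_ground q)) // !andbT.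
  apply/negP => /(subsetP qp.1) xI.
  by rewrite (disjointFr (mctr_del q) xI) in xq.
(* A basis of [minor q] together with the newly contracted elements is a basis of [minor p], and it
   avoids [mdel q]. *)
exists (B :|: mctr q :\: mctr p) => //; rewrite subsetUr /=.
rewrite disjoint_subset; apply/subsetP => x; rewrite !inE => /andP[_ xq].
rewrite (disjointFl (mctr_del q) xq) andbF orbF; apply/negP => /(subsetP Bg).
by rewrite !inE xq orbT.
Qed.

(** Adding or removing the sets of [p] matches the embedded minors of [minor p] with those of [M]
    below [p]. By [minor_minor] the matroids are equal, so membership in [C] is preserved. *)
Lemma colimit_minor (C : mclass) (T : finType) (M : matroid T) (p : emb_minor M) :
  is_colimit (fnd_cocone (fun q : emb_minor (minor p) => C T (minor q))) ->
  is_colimit (local_cocone p (fun q => C T (minor q))).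
Proof.
have /choice[psi psiE] (q : {q : emb_minor (minor p) | C T (minor q)}) :
    exists r : {r | emb_le r p /\ C T (minor r)},
    mctr (sval r) = mctr (sval q) :|: mctr p /\ mdel (sval r) = mdel (sval q) :|: mdel p.
  case: q => q Cq; have [r rI rJ] := emb_minor_comp q.
  have rC : emb_le r p /\ C T (minor r).
    by rewrite -(minor_minor rI rJ) /emb_le rI rJ !subsetUr.
  by exists (exist _ r rC).
have quotK (r : emb_minor M) (q : emb_minor (minor p)) : emb_le r p ->
    mctr q = mctr r :\: mctr p -> mdel q = mdel r :\: mdel p ->
    mctr r = mctr q :|: mctr p /\ mdel r = mdel q :|: mdel p.
  move=> [/subsetP rpI /subsetP rpJ] -> ->; split; apply/setP => x; rewrite !inE.
    by case: (boolP (x \in mctr p)) => [/rpI->|]; rewrite ?orbF.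
  by case: (boolP (x \in mdel p)) => [/rpJ->|]; rewrite ?orbF.
have /choice[phi phiE] (r : {r | emb_le r p /\ C T (minor r)}) :
    exists q : {q : emb_minor (minor p) | C T (minor q)},
    mctr (sval r) = mctr (sval q) :|: mctr p /\ mdel (sval r) = mdel (sval q) :|: mdel p.
  case: r => r [rp Cr]; have [q qI qJ] := emb_minor_quot rp.
  have [rI rJ] := quotK _ _ rp qI qJ.
  have Cq : C T (minor q) by rewrite (minor_minor rI rJ).
  by exists (exist _ q Cq).
apply: (@minors_transfer _ _ _ _ _ _ _ _ _ _
  (fun q => mctr (sval q)) (fun r => mctr (sval r) :\: mctr p)
  (fun q => minor_emb_top (sval q)) (fun r => minor_emb_le (proj1 (proj2_sig r)))
  some some psi phi) => //.
- exact: iso_via_id.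
- by move=> q; rewrite (minor_minor (psiE q).1 (psiE q).2); apply: iso_via_id.
- by move=> q; rewrite -(minor_minor (phiE q).1 (phiE q).2); apply: iso_via_id.
(* [mctr q] lies in the ground set of [minor p] and so misses [mctr p]. *)
- move=> q; rewrite pim_Some (psiE q).1; apply/setP => x; rewrite !inE.
  case: (boolP (x \in mctr p)) => xp /=; last by rewrite orbF.
  apply/negP => /(subsetP (mctr_ground _)); by rewrite !inE xp.
- move=> q r [qrI qrJ]; rewrite pim_Some /emb_le.
  rewrite (psiE q).1 (psiE q).2 (psiE r).1 (psiE r).2 !setSU //; split=> //.
  apply/setP => x; rewrite !inE.
  case: (boolP (x \in mctr p)) => xp /=; rewrite ?orbT ?orbF //=.
  apply/negP => /andP[_] /(subsetP (mctr_ground _)); by rewrite !inE xp.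
- by move=> r; rewrite (psiE _).1 (psiE _).2 -(phiE r).1 -(phiE r).2.
Qed.

(** * Embedded minors of isomorphic matroids *)

Section Transport.
Variables (T T' : finType) (M : matroid T) (M' : matroid T').
Variables (f : T -> option T') (g : T' -> option T).
Hypothesis fg : iso_via M M' f g.

Lemma emb_minor_pim (p : emb_minor M) :
  exists2 q : emb_minor M', mctr q = pim f (mctr p) & mdel q = pim f (mdel p).
Proof.
have [B bB /andP[IB JB]] := emb_minor_basis p.
have [bfg fB] := fg; have BM := bases_ground bB.
apply: emb_minor_build.
- by rewrite (pim_disjoint bfg) ?mctr_ground ?mdel_ground ?mctr_del.
- by rewrite (pim_sub bfg) ?mdel_ground.
exists (pim f B); first by rewrite -fB.
by rewrite pimS // (pim_disjoint bfg) ?mdel_ground.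
Qed.

Lemma iso_via_minor (p : emb_minor M) (q : emb_minor M') :
  mctr q = pim f (mctr p) -> mdel q = pim f (mdel p) ->
  iso_via (minor p) (minor q) f g.
Proof.
move=> qI qJ; have [bfg fB] := fg.
have gE : minor_ground q = pim f (minor_ground p).
  rewrite /minor_ground (pimD bfg) ?(pim_full bfg) ?pimU ?qI ?qJ //.
  by rewrite subUset mctr_ground mdel_ground.
have gM : minor_ground p \subset ground M := subsetDl _ _.
split=> [|B BM] /=; first by rewrite gE; apply: bij_via_pim bfg _ gM.
have BM' := subset_trans BM gM.
rewrite !inE BM /= gE pimS //= qI -pimU fB // subUset BM' mctr_ground //.
Qed.

Lemma iso_proper_minor (p : emb_minor M) (q : emb_minor M') :
  mctr q = pim f (mctr p) -> mdel q = pim f (mdel p) ->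
  proper_minor p -> proper_minor q.
Proof.
have pim0 (A : {set T}) : A \subset ground M -> pim f A = set0 -> A = set0.
  move=> AM A0; rewrite -(pimK fg.1 AM) A0; apply/setP => x; rewrite in_set0.
  by apply/negP => /pimP[y]; rewrite inE.
move=> qI qJ np [I0 J0]; apply: np; rewrite qI in I0; rewrite qJ in J0.
by rewrite (pim0 _ (mctr_ground p)) // (pim0 _ (mdel_ground p)).
Qed.

End Transport.

(** Embedded minors are carried along the isomorphism; they stay proper, and stay in [C] since [C]
    is closed under isomorphism. *)
Lemma colimit_lt_iso (C : mclass) (T T' : finType) (M : matroid T)
    (M' : matroid T') f g :
  iso_via M M' f g ->
  is_colimit (fnd_cocone
    (fun p : emb_minor M => proper_minor p /\ C T (minor p))) ->
  is_colimit (fnd_cocone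
    (fun p : emb_minor M' => proper_minor p /\ C T' (minor p))).
Proof.
move=> fg; have gf := iso_via_sym fg.
(* Stated for arbitrary matroids in order to apply to both [fg] and [gf]. *)
have ex (S S' : finType) (N : matroid S) (N' : matroid S') u v :
    iso_via N N' u v -> forall p : {p : emb_minor N | proper_minor p /\ C S (minor p)},
    exists q : {q : emb_minor N' | proper_minor q /\ C S' (minor q)},
    mctr (sval q) = pim u (mctr (sval p)) /\ mdel (sval q) = pim u (mdel (sval p)).
  move=> uv [p [pp Cp]]; have [q qI qJ] := emb_minor_pim uv p.
  have Cq : proper_minor q /\ C S' (minor q).
    split; first exact (iso_proper_minor uv qI qJ pp).
    exact: in_class_iso (via_miso (iso_via_minor uv qI qJ)) Cp.
  by exists (exist _ q Cq).
have /choice[psi psiE] := ex _ _ _ _ _ _ fg.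
have /choice[phi phiE] := ex _ _ _ _ _ _ gf.
apply: (@minors_transfer _ _ _ _ _ _ _ _ _ _
  (fun q => mctr (sval q)) (fun r => mctr (sval r))
  (fun q => minor_emb_top (sval q)) (fun r => minor_emb_top (sval r))
  f g psi phi) => //.
- by move=> p; exact (iso_via_minor fg (psiE p).1 (psiE p).2).
- by move=> p; exact (iso_via_minor gf (phiE p).1 (phiE p).2).
- by move=> p; rewrite (psiE p).1.
- move=> p q [pqI pqJ]; rewrite /emb_le !(psiE _).1 !(psiE _).2 !pimS //.
  by rewrite (pimD fg.1) ?mctr_ground.
- move=> p; rewrite !(psiE _).1 !(psiE _).2 !(phiE _).1 !(phiE _).2.
  by rewrite !(pimK gf.1) ?mctr_ground ?mdel_ground.
Qed.

(** * Fundamental types *)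

Lemma minor_improper (T : finType) (M : matroid T) (p : emb_minor M) :
  mctr p = set0 -> mdel p = set0 -> minor p = M.
Proof.
move=> I0 J0; have gE : minor_ground p = ground M.
  by rewrite /minor_ground I0 J0 setU0 setD0.
apply: matroid_eq => //=; apply/setP => B; rewrite inE gE I0 setU0.
by apply: andb_idl; apply: bases_ground.
Qed.

Lemma improper_minor_exists (T : finType) (M : matroid T) :
  exists2 p : emb_minor M, mctr p = set0 & mdel p = set0.
Proof.
have [B bB] := bases_neq0 M; apply: emb_minor_build.
- by rewrite -setI_eq0 setI0.
- exact: sub0set.
- by exists B; rewrite // sub0set -setI_eq0 set0I eqxx.
Qed.

Lemma card_proper_minor (T : finType) (M : matroid T) (p : emb_minor M) :
  proper_minor p -> #|ground (minor p)| < #|ground M|.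
Proof.
move=> pp; apply: proper_card; rewrite properE subsetDl /=.
apply/negP => /subsetP sub; apply: pp.
by split; apply/setP => x; rewrite inE; apply/negP => xp;
  [have := subsetP (mctr_ground p) _ xp|have := subsetP (mdel_ground p) _ xp];
  move=> /sub; rewrite !inE xp ?orbT.
Qed.

(** The diagram contains the improper minor, which is terminal. *)
Lemma Omega_in (C : mclass) (T : finType) (M : matroid T) :
  C T M -> pis_iso (Omega C M).
Proof.
move=> CM; apply/canonical_isoP; have [p pI pJ] := improper_minor_exists M.
by apply: (colimit_terminal (p := p)) => //; rewrite minor_improper.
Qed.

Lemma Omega_notin (C C0 : mclass) (T : finType) (M : matroid T) :
  subclass C0 C -> ~ C0 T M ->
  (forall p : emb_minor M, proper_minor p -> C T (minor p) ->
     pis_iso (Omega C0 (minor p))) ->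
  pis_iso (Omega C0 M) <-> pis_iso (Omega_lt C M).
Proof.
move=> C0C nC0 loc; rewrite !canonical_isoP; apply: colimit_local => [p C0p|p [pp Cp]].
  split; last exact: C0C.
  (* A minor in [C0] is proper, since the improper one is [M] itself. *)
  by move=> [pI pJ]; apply: nC0; rewrite -(minor_improper pI pJ).
by apply: colimit_minor; apply/canonical_isoP; apply: loc.
Qed.

Lemma Omega_lt_iso (C : mclass) (T T' : finType) (M : matroid T) (M' : matroid T') :
  miso M M' -> pis_iso (Omega_lt C M') -> pis_iso (Omega_lt C M).
Proof.
move=> /miso_via[f [g fg]]; rewrite !canonical_isoP.
exact: colimit_lt_iso (iso_via_sym fg).
Qed.

Definition fund_class (C : mclass) : mclass.
Proof.
apply: (@MClass (fun T M => C T M /\ ~ pis_iso (Omega_lt C M))) => T T' M M' MM'.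
case=> CM nO; split; first exact: in_class_iso MM' CM.
by move=> /(Omega_lt_iso MM').
Defined.

Lemma fund_class_determines (C : mclass) : determines_foundations C (fund_class C).
Proof.
move=> T M; move: {2}#|_| (leqnn #|ground M|) => n.
elim: n M => [|n IHn] M leM CM; last first.
  (* Either [M] is in its own diagram, or [Omega_lt] is invertible and [Omega_notin] carries this
     over, the proper minors being handled by induction. *)
  case: (pselect (fund_class C T M)) => [|nF]; first exact: Omega_in.
  apply/(@Omega_notin C) => // [S N []//|p /card_proper_minor ltp Cp|].
    by apply: IHn Cp; rewrite -ltnS (leq_trans ltp).
  by apply: contrapT => nO; apply: nF.
case: (pselect (fund_class C T M)) => [|nF]; first exact: Omega_in.
(* The ground set is empty here, so there are no proper minors. *)
apply/(@Omega_notin C) => // [S N []//|p /card_proper_minor|].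
  by move=> /leq_trans/(_ leM).
by apply: contrapT => nO; apply: nF.
Qed.

(** If [M] were missing from [C0], then [Omega_notin] would make [Omega_lt C M] invertible. This
    gives both minimality and uniqueness of the fundamental type. *)
Lemma fund_class_min (C C0 : mclass) :
  subclass C0 C -> determines_foundations C C0 -> subclass (fund_class C) C0.
Proof.
move=> C0C det T M [CM nO]; apply: contrapT => nC0; apply: nO.
by apply/(Omega_notin C0C nC0); [move=> p _; apply: det|apply: det].
Qed.

(** For [M] in a minor-closed [C], the class [C0] and its intersection with [C] give the same
    diagram of minors. The intersection therefore determines foundations, and minimality of [C0]
    applies. *)
Lemma fundamental_type_sub (C C0 : mclass) :
  minor_closed C -> fundamental_type C C0 -> subclass C0 C.
Proof.
move=> mC [det min].
have CC0_iso (T T' : finType) (M : matroid T) (M' : matroid T') :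
    miso M M' -> C0 T M /\ C T M -> C0 T' M' /\ C T' M'.
  by move=> MM' [? ?]; split; apply: in_class_iso MM' _.
suff sub : subclass C0 (MClass CC0_iso) by move=> T M /sub[].
apply: min => [T M []//|T M CM].
suff : (fun p : emb_minor M => C0 T (minor p))
  = (fun p => C0 T (minor p) /\ C T (minor p)).
  by have := det T M CM; rewrite /Omega => + E; rewrite E.
by apply/predeqP => p; split=> [? | []//]; split=> //; apply: mC.
Qed.

Theorem theorem7p2 (C : mclass) :
  exists Cfund : mclass,
    [/\ fundamental_type C Cfund,
        (forall C0 : mclass, subclass C0 C \/ minor_closed C ->
           fundamental_type C C0 -> eqclass C0 Cfund)
      & (forall (T : finType) (M : matroid T),
           Cfund T M <-> C T M /\ ~ pis_iso (Omega_lt C M))].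
Proof.
exists (fund_class C); split=> // [|C0 hC0 fC0].
  split=> [|C1 C1F]; first exact: fund_class_determines.
  (* [C1] is contained in [C] because [fund_class C] is. *)
  by apply: fund_class_min => T M /C1F[].
have C0C : subclass C0 C by case: hC0 => // mC; apply: fundamental_type_sub.
have [det min] := fC0; have FC0 := fund_class_min C0C det.
move=> T M; split; last exact: FC0.
(* [fund_class C] is a subclass of [C0] that determines foundations, so minimality of [C0] gives the
   other inclusion. *)
by apply: min => //; apply: fund_class_determines.
Qed.
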